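(* Let $n\ge5$, $p\ge2$, and let $\boldsymbol\lambda\in K_n$ be such that $G_{\boldsymbol\lambda}$ is isomorphic to the cyclic group $\mathbb{Z}_p$. According to the type of $\boldsymbol\lambda$, its multiplicity vector (of length $p$) is: 1. type mC: $(m-2,\,m-1)$ for $p=2$; $(m-1,\,m-1,\,m-1)$ for $p=3$; $(m-1,\,m,\dots,m,\,m-1,\,m-1)$ for $p\ge4$; 2. type 1+mC: $(m-1,\,m-1)$ for $p=2$; $(m,\dots,m,\,m-1,\,m-1)$ for $p\ge3$; 3. type 2+mC: $(m,\dots,m,\,m-1)$.
   Context: $K_n=\{\boldsymbol\lambda=(\lambda^1,\dots,\lambda^{n-3})\in\mathbb{C}^{n-3}\mid \lambda^i\neq 0,1,\ \lambda^i\neq\lambda^j \text{ for } i\neq j\}$. For $\boldsymbol\lambda\in K_n$ put $z^{\boldsymbol\lambda}_1=0$, $z^{\boldsymbol\lambda}_2=1$, $z^{\boldsymbol\lambda}_3=\infty$, $z^{\boldsymbol\lambda}_{i+3}=\lambda^i$, and $[\boldsymbol\lambda]=\{z^{\boldsymbol\lambda}_1,\dots,z^{\boldsymbol\lambda}_n\}\subset\widehat{\mathbb{C}}$. For $\sigma\in S_n$, $f^{\boldsymbol\lambda}_\sigma$ is the unique linear fractional transformation (LFT) sending $z^{\boldsymbol\lambda}_{\sigma^{-1}(1)},z^{\boldsymbol\lambda}_{\sigma^{-1}(2)},z^{\boldsymbol\lambda}_{\sigma^{-1}(3)}$ to $0,1,\infty$, and $g_\sigma:K_n\to K_n$, $g_\sigma(\boldsymbol\lambda)=(f^{\boldsymbol\lambda}_\sigma(z^{\boldsymbol\lambda}_{\sigma^{-1}(4)}),\dots,f^{\boldsymbol\lambda}_\sigma(z^{\boldsymbol\lambda}_{\sigma^{-1}(n)}))$.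 $G=\{g_\sigma\}$ is a group under composition ($g_\pi g_\sigma=g_{\pi\sigma}$; for $n\ge5$, $\sigma\mapsto g_\sigma$ is injective), $G_{\boldsymbol\lambda}$ is the stabilizer of $\boldsymbol\lambda$ in $G$, $\mathcal{A}_{\alpha}$ is the group of LFTs preserving a set $\alpha$, and $\Phi_{\boldsymbol\lambda}:G_{\boldsymbol\lambda}\to\mathcal{A}_{[\boldsymbol\lambda]}$, $g_\sigma\mapsto f^{\boldsymbol\lambda}_\sigma$, is a group isomorphism. $X_{\boldsymbol\lambda}:G_{\boldsymbol\lambda}\to \mathrm{GL}_{n-3}(\mathbb{C})$ is the representation sending $g_\sigma$ to the Jacobian matrix of $g_\sigma$ at $\boldsymbol\lambda$. Types. Two subsets of $\widehat{\mathbb{C}}$ are equivalent if an LFT carries one onto the other. For $z\in\mathbb{C}^*$ put $C_p(z)=\{e^{\frac kp2\pi i}z\mid k\in\mathbb{Z}\}$, and let $C=C_p(a_1)\cup\cdots\cup C_p(a_m)$ be a union of $m\ge1$ distinct such orbits. $\boldsymbol\lambda$ is of type mC, 1+mC, 2+mC if $[\boldsymbol\lambda]$ is equivalent to a set of the form $C$, $\{0\}\cup C$, $\{0,\infty\}\cup C$, respectively. Multiplicity vector. Put $w=e^{2\pi i/p}$. For types mC and 2+mC let $\rho\in G_{\boldsymbol\lambda}$ be an element such that $\Phi_{\boldsymbol\lambda}(\rho)$ is conjugate (in the group of LFTs) to a rotation of $\frac{2\pi}p$ (the result does not depend on the choice). For type 1+mC, let $a$ be the common fixed index ($\sigma(a)=a$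 for all $g_\sigma\in G_{\boldsymbol\lambda}$), let $\psi$ be any LFT with $\psi(z^{\boldsymbol\lambda}_a)=0$ and $\psi\circ\Phi_{\boldsymbol\lambda}(G_{\boldsymbol\lambda})\circ\psi^{-1}=\langle z\mapsto wz\rangle$, and let $\rho\in G_{\boldsymbol\lambda}$ be the element with $\psi\circ\Phi_{\boldsymbol\lambda}(\rho)\circ\psi^{-1}(z)=wz$. In all cases $\rho$ generates $G_{\boldsymbol\lambda}$, and for $1\le l\le p$ let $X^{(l)}$ be the one-dimensional representation with $X^{(l)}(\rho^k)=w^{kl}$. If $X_{\boldsymbol\lambda}\cong a_1X^{(1)}\oplus\cdots\oplus a_pX^{(p)}$, the multiplicity vector of $\boldsymbol\lambda$ is $(a_1,\dots,a_p)$. *)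

(* Defs.v *)
From mathcomp Require Import all_boot all_order all_algebra all_fingroup.
From mathcomp Require Import all_classical all_reals all_analysis.
From mathcomp Require Import complex.

Set Implicit Arguments.
Unset Strict Implicit.
Unset Printing Implicit Defensive.

Import Order.TTheory GRing.Theory Num.Theory.
Import numFieldNormedType.Exports.

Local Open Scope classical_set_scope.
Local Open Scope ring_scope.
Local Open Scope complex_scope.

Section RiemannSphere.
Variable R : realType.
Local Notation C := R[i].

(* The Riemann sphere: None is the point at infinity. *)
Local Notation sphere := (option C).

(* z |-> (a z + b) / (c z + d) for A = [a, b; c, d]. *)
Definition moebius (A : 'M[C]_2) (z : sphere) : sphere :=
  match z with
  | Some x =>
      if A 1 0 * x + A 1 1 == 0 then None
      else Some ((A 0 0 * x + A 0 1) / (A 1 0 * x + A 1 1))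
  | None => if A 1 0 == 0 then None else Some (A 0 0 / A 1 0)
  end.

Definition is_lft (f : sphere -> sphere) : Prop :=
  exists2 A : 'M[C]_2, A \in unitmx & f = moebius A.

Definition equivalent (A B : set sphere) : Prop :=
  exists2 f, is_lft f & f @` A = B.

(* e^{i t} for real t *)
Definition expi (t : R) : C := cos t +i* sin t.

(* w = e^{2 pi i / p} *)
Definition wroot (p : nat) : C := expi (2 * pi / p%:R).

(* z |-> c z, fixing infinity *)
Definition scaling (c : C) : sphere -> sphere := omap (fun z => c * z).

(* h = psi o f o psi^-1, for a bijective psi *)
Definition conjugated_by (psi f h : sphere -> sphere) : Prop :=
  h \o psi = psi \o f.

Definition Cp (p : nat) (z : C) : set C :=
  [set expi (k%:~R / p%:R * (2 * pi)) * z | k in [set: int]].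

(* S is a union of m >= 1 distinct orbits Cp p (a_i), with a_i in C^* *)
Definition union_of_orbits (p m : nat) (S : set sphere) : Prop :=
  (0 < m)%N /\
  exists a : 'I_m -> C,
    [/\ forall i, a i != 0,
        injective (fun i => Cp p (a i)) &
        S = \bigcup_(i in [set: 'I_m]) (Some @` Cp p (a i))].

End RiemannSphere.

(* Throughout, n = 3 + k, so that K_n is a subset of C^k, the indices 1, .., n
   are the elements of 'I_(3 + k), the indices 1, 2, 3 being lshift k 0,
   lshift k 1, lshift k 2, and the index i + 3 being rshift 3 i. *)
Section Configurations.
Variables (R : realType) (k : nat).
Local Notation C := R[i].
Local Notation sphere := (option C).
Local Notation endo := ('rV[C]_k -> 'rV[C]_k).
Implicit Types (l : 'rV[C]_k) (s t : 'S_(3 + k)) (g rho : endo).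

Definition Kn : set 'rV[C]_k :=
  [set l | (forall i, l 0 i != 0 /\ l 0 i != 1) /\
           (forall i j, i != j -> l 0 i != l 0 j)].

Definition pt l (i : 'I_(3 + k)) : sphere :=
  match fintype.split i with
  | inl i => nth None [:: Some 0; Some 1; None] i
  | inr i => Some (l 0 i)
  end.

(* f^l_s; the identity is a default value, never used when l is in Kn. *)
Definition flft l s : sphere -> sphere :=
  @xget (sphere -> sphere) id [set f | [/\ is_lft f,
    f (pt l ((s^-1)%g (lshift k 0))) = Some 0,
    f (pt l ((s^-1)%g (lshift k 1))) = Some 1 &
    f (pt l ((s^-1)%g (lshift k 2%:R))) = None]].

(* g_s : Kn -> Kn, extended by the identity outside Kn, so that equality and
   composition of the g_s as maps of C^k are those of maps of Kn. *)
Definition gmap s : endo := fun l =>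
  if l \in Kn
  then \row_i odflt 0 (flft l s (pt l ((s^-1)%g (rshift 3 i))))
  else l.

Definition Ggroup : set endo := range gmap.

Definition stab l : set endo := [set g | Ggroup g /\ g l = l].

(* Isomorphism of 'Z_p (for p > 1) with the group (stab l, \o). *)
Definition stab_isog_Zp l (p : nat) : Prop :=
  exists h : 'Z_p -> endo,
    [/\ injective h, range h = stab l & forall a b, h (a + b) = h a \o h b].

(* X_l. The library's jacobian acts on row vectors on the right; its transpose
   is the usual matrix with (i, j) entry d g_i / d l^j. *)
Definition jac l g : 'M[C]_k := (jacobian g l)^T.

Definition type_mC l (p m : nat) : Prop :=
  exists2 S, union_of_orbits p m S & equivalent (range (pt l)) S.

Definition type_1mC l (p m : nat) : Prop :=
  exists2 S, union_of_orbits p m S &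
    equivalent (range (pt l)) ([set Some 0] `|` S).

Definition type_2mC l (p m : nat) : Prop :=
  exists2 S, union_of_orbits p m S &
    equivalent (range (pt l)) ([set Some 0; None] `|` S).

(* The elements rho = g_s of G_l admissible for the types mC and 2+mC; the map
   Phi_l sends g_s to f^l_s = flft l s. *)
Definition generator02 l (p : nat) rho : Prop :=
  exists s, [/\ rho = gmap s, gmap s l = l &
    exists2 psi, is_lft psi &
      conjugated_by psi (flft l s) (scaling (wroot R p))].

(* The elements rho = g_s of G_l admissible for the type 1+mC; a is the common
   fixed index, and the set equality is psi Phi_l(G_l) psi^-1 = <z |-> wz>. *)
Definition generator1 l (p : nat) rho : Prop :=
  exists s, [/\ rho = gmap s, gmap s l = l &
    exists (a : 'I_(3 + k)) (psi : sphere -> sphere),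
      [/\ forall t, gmap t l = l -> t a = a,
          is_lft psi,
          psi (pt l a) = Some 0,
          [set h | exists2 t, gmap t l = l & conjugated_by psi (flft l t) h]
            = [set scaling (wroot R p ^+ j) | j in [set: nat]] &
          conjugated_by psi (flft l s) (scaling (wroot R p))]].

(* X^(j) : rho^e |-> w^(e j), well defined on the powers of rho when rho has
   order p. *)
Definition Xchar (p : nat) rho (j : nat) : endo -> C := fun g =>
  wroot R p ^+ (xget 0%N [set e : nat | g = iter e rho] * j).

(* X_l is isomorphic to the direct sum of the a_j X^(j), 1 <= j <= p, where
   a = [:: a_1; ...; a_p]; P is an invertible intertwining matrix. *)
Definition jac_decomposition l (p : nat) rho (a : seq nat) : Prop :=
  size a = p /\
  exists (P : 'M[C]_(k, \sum_(j < p) nth 0%N a j))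
         (Q : 'M[C]_(\sum_(j < p) nth 0%N a j, k)),
    [/\ P *m Q = 1%:M, Q *m P = 1%:M &
      forall g, stab l g ->
        jac l g *m P =
        P *m \mxdiag_(j < p) ((Xchar p rho j.+1 g)%:M : 'M[C]_(nth 0%N a j))].

(* a is the multiplicity vector of l: admissible elements rho exist, and the
   decomposition given by any of them is a. *)
Definition mult_vector02 l (p : nat) (a : seq nat) : Prop :=
  (exists rho, generator02 l p rho) /\
  (forall rho, generator02 l p rho -> jac_decomposition l p rho a).

Definition mult_vector1 l (p : nat) (a : seq nat) : Prop :=
  (exists rho, generator1 l p rho) /\
  (forall rho, generator1 l p rho -> jac_decomposition l p rho a).

End Configurations.

(* Main.v *)
From HB Require Import structures.
Require Import Defs.
From mathcomp Require Import all_boot all_order all_algebra all_fingroup.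
From mathcomp Require Import all_classical all_reals all_analysis.
From mathcomp Require Import complex.
From mathcomp Require Import ring lra zify.

(** An element g_s of the stabilizer of l acts on the tangent space of Kn at l.
    Since Kn is the space of n = 3 + k distinct points of the sphere modulo
    linear fractional transformations, this tangent space is the sum of the
    tangent lines at the n marked points modulo the vector fields that generate
    the transformations, that is, sl_2.  Its dual is the space of quadratic
    differentials with at most simple poles at the marked points.  If psi
    conjugates f_s to z |-> q z and sends the marked points to u_1, ..., u_n,
    the differentials z^j dz^2 / prod_i (z - u_i), with 0 <= j <= n - 4 and the
    product over the finite u_i, form a basis of that space, and the rotation
    multiplies each of them by a scalar.  The scalar is q^(j + 2 - e0), where
    e0 is 1 if 0 is one of the u_i and 0 otherwise.  Hence X_l contains n - 3
    characters with consecutive exponents, and the multiplicity vectors count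
    the residues modulo p among them.

    In the proof a point of the sphere is a vector of C^2 up to a scalar, so
    that infinity is an ordinary point; z_i - z_j becomes the determinant
    [br], the polynomials of degree d are represented by products of d linear
    forms [bform], and [pairing] evaluates the corresponding quadratic differential
    on a tangent vector.  [sum_residues] (a sum of residues is zero) says that
    the pairing vanishes on sl_2.  [gmap_tangent] differentiates the relation
    between the normalized points of g_s(z) and the images of the points of z
    under f_s; modulo sl_2 the derivative of g_s is then the action of f_s on
    tangent vectors.  [pairing_push] transports this to quadratic
    differentials, [pairing_rotation] computes the scalar above, and
    [mono_unitmx] (interpolation) shows that the monomials form a basis.
    [block_diagonalize] turns this eigenbasis into the matrices of a
    decomposition.

    It remains to control the stabilizer.  The isomorphism with Z_p counts maps
    g_s, so one needs that g_s determines s.  Here n >= 5 enters, through the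
    same pairing ([gmap_inj_stab]): for n = 4 the quadratic differentials form
    a line and do not separate the points.  The stabilizer then consists of p
    permutations, hence of the powers of any of its elements that is conjugate
    to a rotation of 2 pi / p ([stab_generated]).  All these powers, except the
    identity, have the same fixed points, so the type determines which marked
    points an admissible psi sends to the set {0, infinity}
    ([polar_transfer]). *)

Set Implicit Arguments.
Unset Strict Implicit.
Unset Printing Implicit Defensive.

Import Order.TTheory GRing.Theory Num.Theory.
Import numFieldNormedType.Exports.

Local Open Scope ring_scope.

(** * Binary forms and the pairing with quadratic differentials *)

Section Plane.
Variable K : fieldType.
Implicit Types (u v w : K * K) (E F A : 'M[K]_2) (hs : seq (K * K)).

(** For points z = u.1 / u.2 and t = v.1 / v.2, this is u.2 * v.2 * (z - t): the
    difference z - t freed of denominators, which also makes sense at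
    infinity. *)
Definition br u v : K := u.1 * v.2 - v.1 * u.2.

Lemma brvv v : br v v = 0. Proof. by rewrite /br subrr. Qed.

Lemma br_anti u v : br u v = - br v u.
Proof. rewrite /br; ring. Qed.

(** The linear form [br _ u] in the basis formed by [br _ a] and [br _ b]. *)
Lemma br_plucker u v a b : br v u * br a b = br v a * br u b - br v b * br u a.
Proof. rewrite /br; ring. Qed.

Definition lin F v : K * K :=
  (F 0 0 * v.1 + F 0 1 * v.2, F 1 0 * v.1 + F 1 1 * v.2).

(** The adjugate of F applied to v, hence the adjoint of F for [br]. *)
Definition colin F v : K * K :=
  (F 1 1 * v.1 - F 0 1 * v.2, F 0 0 * v.2 - F 1 0 * v.1).

Lemma det_mx22 F : \det F = F 0 0 * F 1 1 - F 0 1 * F 1 0.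
Proof.
rewrite (expand_det_row _ 0) !big_ord_recl big_ord0 /cofactor !det_mx11 !mxE /=.
have -> : lift 0 0 = 1 :> 'I_2 by apply/val_inj.
have -> : lift (1 : 'I_2) 0 = 0 :> 'I_2 by apply/val_inj.
by rewrite /= expr0 expr1; ring.
Qed.

Lemma br_lin F u v : br (lin F u) (lin F v) = \det F * br u v.
Proof. rewrite det_mx22 /br /lin /=; ring. Qed.

Lemma br_colin F u v : br (lin F u) v = br u (colin F v).
Proof. rewrite /br /lin /colin /=; ring. Qed.

Definition scalev (c : K) v : K * K := (c * v.1, c * v.2).

Lemma brZl c u v : br (scalev c u) v = c * br u v.
Proof. rewrite /br /scalev /=; ring. Qed.

Lemma brZr c u v : br u (scalev c v) = c * br u v.
Proof. rewrite /br /scalev /=; ring. Qed.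

Lemma linM E F v : lin (E *m F) v = lin E (lin F v).
Proof.
have l01 : lift ord0 (ord0 : 'I_1) = 1 :> 'I_2 by apply/val_inj.
rewrite /lin !mxE /= !big_ord_recl !big_ord0 /= !l01 /=.
by congr pair; ring.
Qed.

(** Every linear form on the plane is [br _ w] for a unique w, so that a list of
    vectors encodes a binary form that is a product of linear forms.  This
    class contains the monomials, is stable under linear substitutions, and
    suffices for all that follows. *)
Definition bform hs v : K := \prod_(w <- hs) br v w.

Lemma bform_cat hs hs' v : bform (hs ++ hs') v = bform hs v * bform hs' v.
Proof. exact: big_cat. Qed.

Lemma bform2 a b v : bform [:: a; b] v = br v a * br v b.
Proof. by rewrite /bform !big_cons big_nil mulr1. Qed.

Lemma bformZ hs c v : bform hs (scalev c v) = c ^+ size hs * bform hs v.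
Proof.
elim: hs => [|w hs IH]; first by rewrite /bform !big_nil expr0 mul1r.
rewrite /bform !big_cons -!/(bform _ _) IH brZl exprS; ring.
Qed.

Lemma bform_lin hs F v : bform hs (lin F v) = bform (map (colin F) hs) v.
Proof. by rewrite /bform big_map; apply: eq_bigr => w _; rewrite br_colin. Qed.

Section Points.
Variables (I : finType) (v : I -> K * K).
Hypothesis v_free : forall a b, a != b -> br (v a) (v b) != 0.

(** The residue theorem for the differential h(z) dz / prod_b (z - v_b), where
    the degree of h is at most #|J| - 2: the residues at the v_b add up to zero.
    The proof removes one linear factor of h at a time: written in the basis
    [br _ (v a1)], [br _ (v a2)], this factor cancels a1 or a2 from the
    denominators, which leaves the same sum for one point and one factor less. *)
Lemma sum_residues_on hs (J : {set I}) : #|J| = (size hs).+2 ->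
  \sum_(a in J) bform hs (v a) / \prod_(b in J :\ a) br (v a) (v b) = 0.
Proof.
elim: hs J => [|w hs IH] J cJ.
  have /cards2P [a [b [nab ->]]] : #|J| == 2 by rewrite cJ.
  have nba : b != a by rewrite eq_sym.
  rewrite big_setU1 /= ?inE // big_set1 /bform !big_nil.
  have -> : [set a; b] :\ a = [set b].
    by apply/setP => x; rewrite !inE; case: eqVneq => //= ->; rewrite (negbTE nab).
  have -> : [set a; b] :\ b = [set a].
    apply/setP => x; rewrite !inE; case: (eqVneq x b) => //= [->|_].
      by rewrite (negbTE nba).
    by rewrite orbF.
  by rewrite !big_set1 (br_anti (v b)) invrN mulrN subrr.
have /card_gt0P [a1 Ja1] : (0 < #|J|)%N by rewrite cJ.
have /card_gt0P [a2] : (0 < #|J :\ a1|)%N.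
  by move: (cardsD1 a1 J); rewrite Ja1 cJ /= add1n => -[<-].
rewrite !inE => /andP [na21 Ja2].
have n12 : br (v a1) (v a2) != 0 by apply: v_free; rewrite eq_sym.
have drop c : c \in J ->
  \sum_(a in J) br (v a) (v c) * bform hs (v a)
      / \prod_(b in J :\ a) br (v a) (v b) = 0.
  move=> Jc; rewrite (big_setD1 c Jc) /= brvv !mul0r add0r.
  have cJc : #|J :\ c| = (size hs).+2.
    by move: (cardsD1 c J); rewrite Jc cJ /= add1n => -[<-].
  rewrite -[RHS](IH _ cJc); apply: eq_bigr => a; rewrite !inE => /andP [nac Ja].
  rewrite (big_setD1 c) /=; last by rewrite !inE eq_sym nac.
  have -> : J :\ c :\ a = J :\ a :\ c by apply/setP => x; rewrite !inE andbCA.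
  have := v_free nac; set x := br _ _ => nx.
  by rewrite invfM mulrACA divff // mul1r.
have key a : bform (w :: hs) (v a) =
   (br w (v a2) / br (v a1) (v a2)) * (br (v a) (v a1) * bform hs (v a))
   - (br w (v a1) / br (v a1) (v a2)) * (br (v a) (v a2) * bform hs (v a)).
  rewrite /bform big_cons -/(bform _ _).
  apply: (mulIf n12); rewrite mulrAC br_plucker; field; exact: n12.
rewrite (eq_bigr (fun a =>
    (br w (v a2) / br (v a1) (v a2)) * (br (v a) (v a1) * bform hs (v a)
       / \prod_(b in J :\ a) br (v a) (v b))
  - (br w (v a1) / br (v a1) (v a2)) * (br (v a) (v a2) * bform hs (v a)
       / \prod_(b in J :\ a) br (v a) (v b)))); last first.
  by move=> a _; rewrite key mulrBl !mulrA.
by rewrite sumrB -!mulr_sumr !drop // !mulr0 subr0.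
Qed.

Definition den a : K := \prod_(b | b != a) br (v a) (v b).

Lemma den_neq0 a : den a != 0.
Proof. by apply/prodf_neq0 => b nba; apply: v_free; rewrite eq_sym. Qed.

Lemma sum_residues hs : #|I| = (size hs).+2 ->
  \sum_a bform hs (v a) / den a = 0.
Proof.
move=> cI; rewrite -[RHS](@sum_residues_on hs [set: I]) ?cardsT //.
apply: eq_big => [a|a _]; first by rewrite inE.
by congr (_ / _); apply: eq_bigl => b; rewrite !inE andbT.
Qed.

(** The pairing of the quadratic differential h(z) dz^2 / prod_b (z - v_b), for h
    of degree #|I| - 4, with an infinitesimal displacement of the points.  The
    value theta a stands for [br (v a) dv], where dv is the displacement of v a;
    it equals - (v a).2 ^+ 2 times the velocity of the point (v a).1 / (v a).2. *)
Definition pairing hs (theta : I -> K) : K :=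
  \sum_a bform hs (v a) * theta a / den a.

(** A transformation F that permutes the points v_a up to scalars moves a tangent
    vector theta to eta, up to the vector field of the matrix E.  The vector
    field contributes the values of a quadratic form, and so it pairs to a sum
    of residues, which vanishes; what is left is the pull-back of h by F, times a
    constant. *)
Lemma pairing_push hs (F E : 'M[K]_2) (s : {perm I}) (c theta eta : I -> K) :
  #|I| = (size hs).+4 -> \det F != 0 -> (forall a, c a != 0) ->
  (forall a, lin F (v a) = scalev (c a) (v (s a))) ->
  (forall a, c a ^+ 2 * eta (s a)
     = \det F * theta a + br (lin F (v a)) (lin E (v a))) ->
  pairing hs eta = (\prod_a c a) / \det F ^+ (size hs).+2
     * pairing (map (colin F) hs) theta.
Proof.
move=> cI dF0 c0 Fv ceta; set N := size hs; set d := \det F; set P := \prod_a c a.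
have P0 : P != 0 by apply/prodf_neq0.
have denE a : den (s a) * (c a ^+ N.+2 * P) = d ^+ N.+3 * den a.
  have -> : den (s a) = \prod_(b | b != a) br (v (s a)) (v (s b)).
    rewrite /den (reindex_inj (@perm_inj _ s)) /=.
    by apply: eq_bigl => b; rewrite (inj_eq perm_inj).
  have cards : #|[pred b | b != a]| = N.+3.
    have := cardC1 a; rewrite cI /= => <-; exact: eq_card.
  have -> : d ^+ N.+3 = \prod_(b | b != a) d by rewrite prodr_const -cards.
  have -> : P = c a * \prod_(b | b != a) c b by rewrite /P (bigD1 a).
  rewrite (_ : _ * (c a * _) = (c a ^+ N.+3) * \prod_(b | b != a) c b); last first.
    by rewrite (exprSr _ N.+2) mulrA.
  have -> : c a ^+ N.+3 = \prod_(b | b != a) c a by rewrite prodr_const -cards.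
  rewrite -!big_split /=; apply: eq_bigr => b _.
  by rewrite -br_lin !Fv brZl brZr; ring.
(* The two coordinates of a vector are its brackets with (0, 1) and (-1, 0). *)
have term a : bform hs (v (s a)) * eta (s a) / den (s a) =
   P / d ^+ N.+2 * (bform (map (colin F) hs) (v a) * theta a / den a)
   + P / d ^+ N.+3 *
     (bform (map (colin F) hs ++ [:: colin F (0, 1); colin E (-1, 0)]) (v a) / den a
    - bform (map (colin F) hs ++ [:: colin E (0, 1); colin F (-1, 0)]) (v a) / den a).
  rewrite !bform_cat -!bform_lin !bform2 -!br_colin.
  rewrite Fv bformZ -/N.
  have -> : eta (s a) = (d * theta a + br (lin F (v a)) (lin E (v a))) / c a ^+ 2.
    by rewrite -ceta mulrAC divff ?mul1r // expf_neq0.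
  have -> : den (s a) = d ^+ N.+3 * den a / (c a ^+ N.+2 * P).
    by rewrite -denE mulfK // mulf_neq0 // expf_neq0.
  rewrite -?Fv /br /=.
  have h1 : d ^+ N != 0 by rewrite expf_neq0.
  have h2 : c a ^+ N != 0 by rewrite expf_neq0.
  rewrite (exprD _ 2 N) (exprD _ 3 N) (exprD _ 2 N).
  move: (den a) (c a) (c0 a) (den_neq0 a) h1 h2 P0 => D C hC hD.
  rewrite -/d; move: dF0; rewrite -/d; move: (P) (d) => P1 d1.
  move: (d1 ^+ N) (C ^+ N) => dN cN hd hdN hcN hP.
  by field; rewrite hD hdN hd hP hcN hC.
rewrite {1}/pairing (reindex_inj (@perm_inj _ s)) /=.
under eq_bigr do rewrite term.
rewrite big_split /= -!mulr_sumr sumrB !sum_residues ?subrr ?mulr0 ?addr0 //;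
  by rewrite size_cat size_map /= addn2.
Qed.

End Points.

(** The form X^j Y^(N - j), since X = br u (0, 1) and Y = br u (-1, 0). *)
Definition mono N j : seq (K * K) := nseq j (0, 1) ++ nseq (N - j) (-1, 0).

Lemma bform_mono N j u : bform (mono N j) u = u.1 ^+ j * u.2 ^+ (N - j).
Proof.
rewrite /bform big_cat /= !big_nseq /br /= !mulr1 !mulr0 !mul0r !mulN1r.
by rewrite subr0 sub0r opprK !iter_mulr_1.
Qed.

Lemma size_mono N j : (j <= N)%N -> size (mono N j) = N.
Proof. by move=> jN; rewrite size_cat !size_nseq subnKC. Qed.

Lemma bform_expand hs : exists c : nat -> K, forall u,
  bform hs u = \sum_(j < (size hs).+1) c j * bform (mono (size hs) j) u.
Proof.
elim: hs => [|w hs [c IH]].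
  exists (fun=> 1) => u.
  by rewrite big_ord_recl big_ord0 addr0 mul1r.
set N := size hs in IH *.
exists (fun j => (if j is j'.+1 then w.2 * c j' else 0)
               - (if (j <= N)%N then w.1 * c j else 0)) => u.
have -> : bform (w :: hs) u = br u w * bform hs u by rewrite /bform big_cons.
rewrite IH /=; under [RHS]eq_bigr do rewrite mulrBl.
rewrite sumrB [X in _ = X - _]big_ord_recl /= mul0r add0r.
rewrite [X in _ = _ - X]big_ord_recr /=.
rewrite ltnn mul0r addr0 /br mulrBl; congr (_ - _); rewrite mulr_sumr.
  apply: eq_bigr => j _; rewrite !bform_mono /= /bump /= add1n subSS exprS; ring.
apply: eq_bigr => j _; rewrite -ltnS ltn_ord !bform_mono subSn ?exprS; last by rewrite -ltnS.
by ring.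
Qed.

(** Interpolation: for each point there is a form of degree k - 1 that vanishes at
    the k - 1 other points and not at this one, and it is a combination of
    monomials.  The factors d only rescale the rows. *)
Lemma mono_unitmx k (u : 'I_k -> K * K) (d : 'I_k -> K) :
  (forall i j, i != j -> br (u i) (u j) != 0) -> (forall i, d i != 0) ->
  \matrix_(i < k, j < k) (bform (mono k.-1 j) (u i) * d i) \in unitmx.
Proof.
move=> u_free d0; pose hs i := [seq u m | m in predC1 i].
have size_hs i : size (hs i) = k.-1 by rewrite size_image cardC1 card_ord.
have form_hs i m : (bform (hs i) (u m) != 0) = (m == i).
  rewrite /bform /hs big_image /=.
  case: (eqVneq m i) => [->|nmi].
    by apply/prodf_neq0 => b; rewrite inE eq_sym; apply: u_free.
  by apply/negbF/prodf_eq0; exists m; rewrite ?inE // brvv.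
have [c formE] : exists c : 'I_k -> nat -> K, forall i v,
    bform (hs i) v = \sum_(j < k) c i j * bform (mono k.-1 j) v.
  have /fin_all_exists [c cP] i := bform_expand (hs i).
  exists c => i v; rewrite cP size_hs prednK //; exact: leq_trans (ltn_ord i).
set W := \matrix_(i, j) _; pose Z := \matrix_(j < k, i < k) c i j.
suff : W *m Z \in unitmx by rewrite unitmx_mul => /andP [].
have -> : W *m Z = diag_mx (\row_i (d i * bform (hs i) (u i))).
  apply/matrixP => i i'; rewrite !mxE.
  transitivity (d i * bform (hs i') (u i)).
    rewrite formE mulr_sumr; apply: eq_bigr => j _; rewrite !mxE; ring.
  case: eqVneq => [->|nii']; first by rewrite mulr1n.
  by move: (form_hs i' i); rewrite (negbTE nii') mulr0n => /negbFE/eqP ->; rewrite mulr0.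
rewrite unitmxE det_diag unitfE; apply/prodf_neq0 => i _.
by rewrite mxE mulf_neq0 // form_hs.
Qed.

Lemma lin_eq0 A v : \det A != 0 -> lin A v = (0, 0) -> v = (0, 0).
Proof.
move=> A0 Av; have h u : br v u = 0.
  by apply: (mulfI A0); rewrite mulr0 -br_lin Av /br /= !mul0r mulr0 subrr.
move: (h (0, 1)) (h (1, 0)); case: v {Av h} => x y; rewrite /br /=.
by rewrite !mulr0 !mulr1 !mul0r !mul1r subr0 sub0r => -> /eqP; rewrite oppr_eq0 => /eqP ->.
Qed.

Section Rotation.
Variables (I : finType) (v : I -> K * K).
Hypothesis v_free : forall a b, a != b -> br (v a) (v b) != 0.
Variables (A F : 'M[K]_2) (q kappa : K) (s : {perm I}) (c : I -> K).
Hypothesis v0 : forall a, v a != (0, 0).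
Hypotheses (A0 : \det A != 0) (q0 : q != 0) (kappa0 : kappa != 0).
Hypothesis c0 : forall a, c a != 0.
Hypothesis Fv : forall a, lin F (v a) = scalev (c a) (v (s a)).
Hypothesis AF : forall u,
  lin A (lin F u) = scalev kappa (q * (lin A u).1, (lin A u).2).

Lemma det_rotation : \det F = kappa ^+ 2 * q.
Proof.
apply: (mulfI A0); rewrite -[LHS]mulr1.
have -> : 1 = br (1, 0) (0, 1) :> K by rewrite /br /= mulr1 mul0r subr0.
rewrite -mulrA -!br_lin !AF brZl brZr.
transitivity (kappa ^+ 2 * q * br (lin A (1, 0)) (lin A (0, 1))).
  rewrite /br /=; ring.
by rewrite br_lin /br /=; ring.
Qed.

(** In the coordinates of A the map sends (X, Y) to kappa (q X, Y).  The second
    coordinate shows that c a is kappa times a quotient of the values of Y at a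
    and at s a, unless a is the point at infinity, which is fixed and has
    c a = kappa q.  The quotients cancel in the product. *)
Lemma prod_rotation :
  \prod_a c a = kappa ^+ #|I| * q ^+ #|[pred a | (lin A (v a)).2 == 0%R]|.
Proof.
(* The value 1 at infinity makes the quotient Y a / Y (s a) trivial there. *)
pose Y a := if (lin A (v a)).2 == 0 then 1 else (lin A (v a)).2.
have Y0 a : Y a != 0 by rewrite /Y; case: ifPn; rewrite ?oner_neq0.
have AFv a : scalev (c a) (lin A (v (s a))) =
             scalev kappa (q * (lin A (v a)).1, (lin A (v a)).2).
  by rewrite -AF Fv /lin /scalev /=; congr pair; ring.
have cE a : c a = kappa * (if (lin A (v a)).2 == 0 then q else 1) * (Y a / Y (s a)).
  have [/= e1 e2] := AFv a; rewrite /Y.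
  case: eqVneq => [Ya0|Ya0]; last first.
    have : c a * (lin A (v (s a))).2 != 0 by rewrite e2 mulf_neq0.
    rewrite mulf_eq0 negb_or => /andP [_ Ysa]; rewrite (negbTE Ysa).
    by rewrite mulr1 mulrA -e2 mulfK.
  have Ysa : (lin A (v (s a))).2 == 0.
    by move/eqP: e2; rewrite Ya0 mulr0 mulf_eq0 (negbTE (c0 a)).
  rewrite Ysa divr1 mulr1.
  have sa : s a = a.
    apply/eqP; apply: contraT => /v_free; rewrite -(inj_eq (mulfI A0)) -br_lin mulr0.
    by move: Ysa Ya0; rewrite /br /= => /eqP -> ->; rewrite !mulr0 subrr eqxx.
  have : c a * (lin A (v a)).1 = kappa * q * (lin A (v a)).1.
    by rewrite -mulrA -e1 sa.
  apply: mulIf; apply/eqP => X0; move: (v0 a).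
  have : lin A (v a) = (0, 0) by move: X0 Ya0; rewrite /lin /= => -> ->.
  by move/(lin_eq0 A0) ->; rewrite eqxx.
rewrite (eq_bigr _ (fun a _ => cE a)) 2!big_split /= prodr_const.
have -> : \prod_a (Y a / Y (s a)) = 1.
  rewrite prodf_div [X in X / _](reindex_inj (@perm_inj _ s)) /= divff //.
  exact/prodf_neq0.
rewrite mulr1.
by rewrite -big_mkcond /= prodr_const.
Qed.

(** The eigenvalue of z^j dz^2 / prod_b (z - u_b) under z |-> q z.  The factor q^j
    comes from z^j, and the rest from [prod_rotation] and [det_rotation].  The
    total exponent is j + einf - (N + 2), where einf is the number of marked
    points at infinity, and it is reduced with q^p = 1 and N + 4 = m p + e0 +
    einf. *)
Lemma pairing_rotation m p e0 N j (E : 'M[K]_2) (theta eta : I -> K) :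
  #|I| = N.+4 -> (j <= N)%N -> q ^+ p = 1 -> (e0 <= 1)%N ->
  #|I| = (m * p + e0 + #|[pred a | (lin A (v a)).2 == 0%R]|)%N ->
  (forall a, c a ^+ 2 * eta (s a)
     = \det F * theta a + br (lin F (v a)) (lin E (v a))) ->
  pairing v (map (colin A) (mono N j)) eta =
  q ^+ (j + 2 - e0) * pairing v (map (colin A) (mono N j)) theta.
Proof.
move=> cI jN qp e01 cI' ceta; set hs := map _ _.
have sz : size hs = N by rewrite size_map size_mono.
have dF0 : \det F != 0 by rewrite det_rotation mulf_neq0 // expf_neq0.
rewrite (pairing_push v_free _ dF0 c0 Fv ceta) ?sz //.
have -> : pairing v (map (colin F) hs) theta = kappa ^+ N * q ^+ j * pairing v hs theta.
  rewrite /pairing mulr_sumr; apply: eq_bigr => a _.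
  rewrite -bform_lin -!(bform_lin _ A) AF bformZ size_mono //= !bform_mono /= exprMn.
  ring.
rewrite mulrA; congr (_ * _).
rewrite prod_rotation det_rotation cI; set e := #|_|.
have -> : q ^+ (j + 2 - e0) = q ^+ (j + e) / q ^+ N.+2.
  apply: (canRL (mulfK _)); first by rewrite expf_neq0.
  rewrite -exprD.
  have -> : (j + 2 - e0 + N.+2 = j + e + m * p)%N.
    by move: cI'; rewrite cI -/e; lia.
  by rewrite (exprD _ _ (m * p)) mulnC exprM qp expr1n mulr1.
rewrite exprMn -exprM (exprD _ 4 N) (exprD _ j) !(exprD _ 2 N) mulnC.
rewrite (_ : N.+2 * 2 = 4 + N + N)%N; last by lia.
rewrite !exprD.
have h1 : q ^+ N != 0 by rewrite expf_neq0.
have h2 : kappa ^+ N != 0 by rewrite expf_neq0.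
by field; rewrite h1 h2 q0 kappa0.
Qed.

End Rotation.
End Plane.

Local Open Scope classical_set_scope.
Local Open Scope complex_scope.

(** * Linear fractional transformations in homogeneous coordinates *)

Section Sphere.
Variable R : realType.
Local Notation C := R[i].
Local Notation sphere := (option C).
Implicit Types (u v : C * C) (A F : 'M[C]_2) (f g psi : sphere -> sphere).

Definition hpoint u : sphere := if u.2 == 0 then None else Some (u.1 / u.2).

Definition rep (z : sphere) : C * C := if z is Some x then (x, 1) else (1, 0).

Lemma repK z : hpoint (rep z) = z.
Proof.
by case: z => [x|]; rewrite /hpoint /= ?eqxx // oner_eq0 divr1.
Qed.

Lemma rep_neq0 z : rep z != (0, 0).
Proof. by case: z => [x|]; rewrite xpair_eqE oner_eq0 ?andbF. Qed.

Lemma moebius_hpoint F u : u != (0, 0) -> moebius F (hpoint u) = hpoint (lin F u).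
Proof.
case: u => x y; rewrite xpair_eqE negb_and /hpoint /moebius /lin /=.
case: (eqVneq y 0) => [->|y0 _] /=.
  rewrite orbF !mulr0 !addr0 mulf_eq0 => x0; rewrite (negbTE x0) orbF.
  by case: ifP => //; rewrite -mulf_div divff // mulr1.
have -> : F 1 0 * (x / y) + F 1 1 = (F 1 0 * x + F 1 1 * y) / y by field.
have -> : F 0 0 * (x / y) + F 0 1 = (F 0 0 * x + F 0 1 * y) / y by field.
rewrite mulf_eq0 invr_eq0 (negbTE y0) orbF; case: ifPn => // n0.
by congr Some; field; rewrite y0 n0.
Qed.

Lemma lin_neq0 F u : \det F != 0 -> u != (0, 0) -> lin F u != (0, 0).
Proof. by move=> F0; apply: contraNneq => /(lin_eq0 F0) ->. Qed.

Lemma moebius_mul A F : \det F != 0 -> moebius (A *m F) = moebius A \o moebius F.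
Proof.
move=> F0; apply/funext => z; rewrite -[z]repK /= !moebius_hpoint ?rep_neq0 ?linM //.
exact/lin_neq0/rep_neq0.
Qed.

Lemma moebius_scalar (c : C) : c != 0 -> moebius c%:M = id.
Proof.
move=> c0; apply/funext => z; rewrite -[z]repK moebius_hpoint ?rep_neq0 //.
rewrite /lin !mxE /= !mulr1n !mulr0n /hpoint /= !mul0r addr0 add0r.
rewrite mulf_eq0 (negbTE c0) /=; case: ifPn => // y0.
by rewrite -mulf_div divff // mul1r.
Qed.

Lemma hpoint_br u v : u != (0, 0) -> v != (0, 0) -> (hpoint u == hpoint v) = (br u v == 0).
Proof.
case: u v => x y [x' y']; rewrite !xpair_eqE !negb_and /hpoint /br /=.
case: (eqVneq y 0) => [->|y0 _]; case: (eqVneq y' 0) => [->|y0'] //=.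
- by move=> _ _; rewrite !mulr0 subrr !eqxx.
- rewrite orbF mulr0 subr0 mulf_eq0 (negbTE y0') orbF.
  by move=> /negbTE ->.
- rewrite orbF mulr0 sub0r oppr_eq0 mulf_eq0 (negbTE y0) orbF.
  by move/negbTE ->.
move=> _; rewrite (inj_eq Some_inj) subr_eq0.
by rewrite -(inj_eq (mulIf y0)) divfK // mulrAC -(inj_eq (mulIf y0')) divfK.
Qed.

Lemma hpoint_eq_scale u v : u != (0, 0) -> v != (0, 0) -> hpoint u = hpoint v ->
  exists2 c : C, c != 0 & u = scalev c v.
Proof.
case: u v => x y [x' y']; rewrite !xpair_eqE !negb_and /hpoint /scalev /=.
case: (eqVneq y 0) => [->|y0 _]; case: (eqVneq y' 0) => [->|y0'] //=.
  rewrite !orbF => x0 x0' _; exists (x / x').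
    by rewrite mulf_neq0 ?invr_eq0.
  by rewrite divfK // mulr0.
move=> _ [e]; exists (y / y'); first by rewrite mulf_neq0 ?invr_eq0.
rewrite divfK //; congr pair.
by rewrite mulrAC -mulrA -e mulrCA divff // mulr1.
Qed.

Lemma is_lft_comp f g : is_lft f -> is_lft g -> is_lft (f \o g).
Proof.
move=> [A uA ->] [B uB ->]; exists (A *m B); first by rewrite unitmx_mul uA.
by rewrite moebius_mul // -unitfE -unitmxE.
Qed.

Lemma is_lft_id : is_lft (id : sphere -> sphere).
Proof. by exists 1%:M; rewrite ?unitmx1 // moebius_scalar ?oner_neq0. Qed.

Lemma is_lft_inv f : is_lft f -> exists g, [/\ is_lft g, cancel f g & cancel g f].
Proof.
move=> [A uA ->]; exists (moebius (invmx A)).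
have dA : \det A != 0 by rewrite -unitfE -unitmxE.
have dA' : \det (invmx A) != 0 by rewrite -unitfE -unitmxE unitmx_inv.
split; first by exists (invmx A); rewrite ?unitmx_inv.
  move=> z; rewrite -[moebius _ _]/((moebius (invmx A) \o moebius A) z).
  by rewrite -moebius_mul // mulVmx // moebius_scalar ?oner_neq0.
move=> z; rewrite -[moebius _ _]/((moebius A \o moebius (invmx A)) z).
by rewrite -moebius_mul // mulmxV // moebius_scalar ?oner_neq0.
Qed.

Lemma is_lft_inj f : is_lft f -> injective f.
Proof. by case/is_lft_inv => g [_ fK _]; apply: can_inj fK. Qed.

(** A transformation that fixes 0, 1 and infinity is given by a scalar matrix;
    this yields both the uniqueness of a transformation with three given values
    and the scalar kappa of [conjugated_lin]. *)
Lemma moebius_fix3 A : A \in unitmx ->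
  moebius A None = None -> moebius A (Some 0) = Some 0 ->
  moebius A (Some 1) = Some 1 -> A 0 0 != 0 /\ A = (A 0 0)%:M.
Proof.
rewrite unitmxE unitfE det_mx22 /moebius /=.
case: (eqVneq (A 1 0) 0) => // c0; rewrite c0 !mulr0 !mul0r !add0r subr0.
rewrite mulf_eq0 negb_or => /andP [a0 d0] _; rewrite (negbTE d0) => -[] /eqP.
rewrite mulf_eq0 invr_eq0 (negbTE d0) orbF => /eqP b0 [].
rewrite b0 addr0 !mulr1 => ad; split=> //.
have {}ad : A 0 0 = A 1 1 by apply: (mulIf (invr_neq0 d0)); rewrite ad divff.
have ord2 (i : 'I_2) : i = 0 \/ i = 1.
  by case: i => -[|[|//]] ?; [left|right]; apply/val_inj.
apply/matrixP => i j; rewrite mxE.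
by case: (ord2 i) (ord2 j) => -> [] ->.
Qed.

Lemma is_lft_eq f g (z : 'I_3 -> sphere) : is_lft f -> is_lft g ->
  (forall i, f (z i) = nth None [:: Some 0; Some 1; None] i) ->
  (forall i, g (z i) = nth None [:: Some 0; Some 1; None] i) -> f = g.
Proof.
move=> lf lg fz gz; have [h [lh gK hK]] := is_lft_inv lg.
suff fh : f \o h = id.
  by apply/funext => x; rewrite -[x in LHS]gK -[LHS]/((f \o h) (g x)) fh.
have fix3 (i : 'I_3) : f (h (nth None [:: Some 0; Some 1; None] i)) =
    nth None [:: Some 0; Some 1; None] i by rewrite -{1}gz gK fz.
have [A uA e] := is_lft_comp lf lh; rewrite e.
have AE x : moebius A x = f (h x) by rewrite -e.
have [|||a0 ->] := moebius_fix3 uA; rewrite ?AE.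
- exact: (fix3 2).
- exact: (fix3 0).
- exact: (fix3 1).
exact: moebius_scalar.
Qed.

Definition diagq (q : C) : 'M[C]_2 := \matrix_(i, j) ((if i == 0 then q else 1) *+ (i == j)).

Lemma lin_diagq q u : lin (diagq q) u = (q * u.1, u.2).
Proof. by rewrite /lin !mxE /= !mulr0n !mulr1n !mul0r addr0 add0r mul1r. Qed.

Lemma det_diagq q : \det (diagq q) = q.
Proof. by rewrite det_mx22 !mxE /= !mulr0n !mulr1n mulr1 mul0r subr0. Qed.

Lemma scalingE q : q != 0 -> scaling q = moebius (diagq q).
Proof.
move=> q0; apply/funext => z; rewrite -[z]repK moebius_hpoint ?rep_neq0 // lin_diagq.
by rewrite /hpoint /=; case: ifP => //= _; rewrite mulrA.
Qed.

(** A conjugacy of transformations of the sphere lifts to matrices only up to a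
    scalar; kappa does not depend on the vector. *)
Lemma conjugated_lin A F q : \det A != 0 -> \det F != 0 -> q != 0 ->
  conjugated_by (moebius A) (moebius F) (scaling q) ->
  exists2 kappa : C, kappa != 0 &
    forall u, lin A (lin F u) = scalev kappa (q * (lin A u).1, (lin A u).2).
Proof.
move=> A0 F0 q0; rewrite /conjugated_by scalingE // -!moebius_mul // => e.
have DA0 : \det (diagq q *m A) != 0 by rewrite det_mulmx det_diagq mulf_neq0.
have AF0 : \det (A *m F) != 0 by rewrite det_mulmx mulf_neq0.
have uDA : diagq q *m A \in unitmx by move: DA0; rewrite -unitfE -unitmxE.
pose B := invmx (diagq q *m A) *m (A *m F).
have uB : B \in unitmx by rewrite unitmx_mul unitmx_inv uDA unitmxE unitfE.
have BE : moebius B = id.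
  rewrite moebius_mul // -e -moebius_mul // mulVmx // moebius_scalar ?oner_neq0 //.
have [|||k0 Bk] := moebius_fix3 uB; rewrite ?BE //.
have AFB : A *m F = diagq q *m A *m B by rewrite mulKVmx.
rewrite {}Bk in AFB; move: (B 0 0) k0 AFB => kappa k0 AFB.
exists kappa => // u; rewrite -linM AFB -mulmxA linM lin_diagq linM.
have -> : lin kappa%:M u = scalev kappa u.
  by rewrite /lin !mxE /= !mulr1n !mulr0n !mul0r addr0 add0r.
by rewrite /lin /scalev /=; congr pair; ring.
Qed.

End Sphere.

(** * Normalized configurations and the maps g_s *)

Section Homogeneous.
Variables (K : fieldType) (k : nat).
Implicit Types (l : 'rV[K]_k) (s : 'S_(3 + k)).

(** Homogeneous coordinates of the points of l; the default (1, 0) of nth is the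
    third point, infinity. *)
Definition vec l (i : 'I_(3 + k)) : K * K :=
  match fintype.split i with
  | inl i => nth (1, 0) [:: (0, 1); (1, 1)] i
  | inr i => (l 0 i, 1)
  end.

Lemma vec_lshift l i : vec l (lshift k i) = nth (1, 0) [:: (0, 1); (1, 1)] i.
Proof. by rewrite /vec (unsplitK (inl i)). Qed.

Lemma vec_rshift l i : vec l (rshift 3 i) = (l 0 i, 1).
Proof. by rewrite /vec (unsplitK (inr i)). Qed.

(** The cross-ratio: the transformation z |-> (z - u0) (u1 - u2) / ((z - u2) (u1 -
    u0)) sends u0, u1, u2 to 0, 1, infinity. *)
Definition cross (u0 u1 u2 : K * K) : 'M[K]_2 :=
  \matrix_(i, j) nth 0 (nth [::] [:: [:: u0.2 * br u1 u2; - u0.1 * br u1 u2];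
                                     [:: u2.2 * br u1 u0; - u2.1 * br u1 u0]] i) j.

Lemma lin_cross u0 u1 u2 v :
  lin (cross u0 u1 u2) v = (br v u0 * br u1 u2, br v u2 * br u1 u0).
Proof. by rewrite /lin !mxE /= /br; congr pair; ring. Qed.

Lemma det_cross u0 u1 u2 :
  \det (cross u0 u1 u2) = br u1 u2 * br u1 u0 * br u0 u2.
Proof. rewrite det_mx22 !mxE /= /br; ring. Qed.

Definition flft_mx l s : 'M[K]_2 :=
  cross (vec l ((s^-1)%g (lshift k 0))) (vec l ((s^-1)%g (lshift k 1)))
        (vec l ((s^-1)%g (lshift k 2))).

End Homogeneous.

Section Configuration.
Variables (R : realType) (k : nat).
Local Notation C := R[i].
Local Notation sphere := (option C).
Implicit Types (l : 'rV[C]_k) (s t : 'S_(3 + k)).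

Lemma pt_lshift l i : pt l (lshift k i) = nth None [:: Some 0; Some 1; None] i.
Proof. by rewrite /pt (unsplitK (inl i)). Qed.

Lemma pt_rshift l i : pt l (rshift 3 i) = Some (l 0 i).
Proof. by rewrite /pt (unsplitK (inr i)). Qed.

Lemma ord3P (P : 'I_3 -> Prop) : P 0 -> P 1 -> P 2 -> forall i, P i.
Proof.
by move=> P0 P1 P2 [[|[|[|//]]] lti];
  [move: P0|move: P1|move: P2]; congr P; apply/val_inj.
Qed.

Lemma hpoint_vec l i : hpoint (vec l i) = pt l i.
Proof.
case: (split_ordP i) => j ->; last first.
  by rewrite vec_rshift pt_rshift /hpoint /= oner_eq0 divr1.
rewrite vec_lshift pt_lshift.
by elim/ord3P: j; rewrite /hpoint /= ?oner_eq0 ?eqxx ?mul0r ?divr1.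
Qed.

Lemma vec_neq0 l i : vec l i != (0, 0).
Proof.
case: (split_ordP i) => j ->; last by rewrite vec_rshift xpair_eqE oner_eq0 andbF.
by rewrite vec_lshift; elim/ord3P: j; rewrite xpair_eqE /= oner_eq0 ?andbF.
Qed.

Lemma KnP l : Kn l <-> injective (pt l).
Proof.
split=> [[l01 ll] a b|inj].
  case: (split_ordP a) => i ->; case: (split_ordP b) => j ->.
  - rewrite !pt_lshift => e; congr lshift; move: e.
    by elim/ord3P: i; elim/ord3P: j => //= -[] /eqP; rewrite ?oner_eq0 // eq_sym oner_eq0.
  - rewrite pt_lshift pt_rshift; have [/eqP n0 /eqP n1] := l01 j.
    by elim/ord3P: i => //= -[] e; [case: n0|case: n1].
  - rewrite pt_lshift pt_rshift; have [/eqP n0 /eqP n1] := l01 i.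
    by elim/ord3P: j => //= -[] e; [case: n0|case: n1].
  rewrite !pt_rshift => -[e]; congr rshift; apply/eqP; apply: contraT => /ll.
  by rewrite e eqxx.
split=> [i|i j]; last first.
  apply: contra => /eqP e; apply/eqP/(@rshift_inj 3); apply: inj.
  by rewrite !pt_rshift e.
have n z : pt l (rshift 3 i) <> pt l (lshift k z) by move/inj/eqP; rewrite eq_rlshift.
split; apply/eqP => e; [apply: (n 0)|apply: (n 1)];
  by rewrite pt_lshift pt_rshift e.
Qed.

Lemma br_vec l a b : Kn l -> a != b -> br (vec l a) (vec l b) != 0.
Proof.
move=> /KnP inj; apply: contra; rewrite -hpoint_br ?vec_neq0 // !hpoint_vec => /eqP.
by move/inj ->.
Qed.

Lemma det_flft_mx l s : Kn l -> \det (flft_mx l s) != 0.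
Proof.
move=> hl; rewrite det_cross !mulf_neq0 //; apply: br_vec => //;
by rewrite (inj_eq perm_inj) (inj_eq (@lshift_inj _ _)).
Qed.

Lemma flft_mx_spec l s i : Kn l ->
  moebius (flft_mx l s) (pt l ((s^-1)%g (lshift k i))) =
  nth None [:: Some 0; Some 1; None] i.
Proof.
move=> hl; have := det_flft_mx s hl; rewrite det_cross !mulf_eq0 !negb_or.
case/andP=> /andP [n12 n10] n02.
rewrite -hpoint_vec moebius_hpoint ?vec_neq0 // lin_cross.
elim/ord3P: i; rewrite /hpoint /=.
- rewrite brvv mul0r mul0r mulf_eq0 (negbTE n02) /= (negbTE n10) //.
- by rewrite mulf_eq0 (negbTE n12) (negbTE n10) /= [X in X / _]mulrC divff // mulf_neq0.
by rewrite brvv mul0r eqxx.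
Qed.

Lemma flft_unique l s f : Kn l -> is_lft f ->
  (forall i, f (pt l ((s^-1)%g (lshift k i))) = nth None [:: Some 0; Some 1; None] i) ->
  flft l s = f.
Proof.
move=> hl lf fz; rewrite /flft; case: xgetP => [g gE [lg g0 g1 g2]|/(_ f) []].
  apply: (is_lft_eq lg lf (z := fun i => pt l ((s^-1)%g (lshift k i)))) => //.
  by elim/ord3P.
by split=> //; rewrite fz.
Qed.

Lemma flftE l s : Kn l -> flft l s = moebius (flft_mx l s).
Proof.
move=> hl; apply: flft_unique => // [|i]; last exact: flft_mx_spec.
by exists (flft_mx l s); rewrite // unitmxE unitfE det_flft_mx.
Qed.

Lemma is_lft_flft l s : Kn l -> is_lft (flft l s).
Proof.
move=> hl; rewrite flftE //.
by exists (flft_mx l s); rewrite // unitmxE unitfE det_flft_mx.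
Qed.

(** The points of g_s(l) are the images of the points of l under f_s, renumbered
    by s.  For the first three indices this is the normalization of f_s, for
    the others the definition of g_s. *)
Lemma flft_pt l s i : Kn l -> flft l s (pt l i) = pt (gmap s l) (s i).
Proof.
move=> hl; rewrite -[in LHS](permK s i); case: (split_ordP (s i)) => j ->.
  by rewrite pt_lshift flftE // flft_mx_spec.
rewrite pt_rshift /gmap mem_set //= mxE.
case e : (flft _ _ _) => [//|].
have /(is_lft_inj (is_lft_flft s hl)) : flft l s (pt l ((s^-1)%g (rshift 3 j))) =
    flft l s (pt l ((s^-1)%g (lshift k 2))) by rewrite e flftE // flft_mx_spec.
by move/((KnP l).1 hl)/perm_inj/eqP; rewrite eq_rlshift.
Qed.

Lemma gmap_Kn l s : Kn l -> Kn (gmap s l).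
Proof.
move=> hl; apply/KnP => a b; rewrite -[a](permKV s) -[b](permKV s) -!flft_pt //.
by move/(is_lft_inj (is_lft_flft s hl))/((KnP l).1 hl) ->.
Qed.

(** A transformation that carries the points of l to those of l' along s must be
    f_s, because it has the three values that characterize f_s. *)
Lemma gmap_unique l l' s f : Kn l -> is_lft f ->
  (forall i, f (pt l i) = pt l' (s i)) -> flft l s = f /\ gmap s l = l'.
Proof.
move=> hl lf fz.
have e : flft l s = f.
  by apply: flft_unique => // i; rewrite fz permKV pt_lshift.
split=> //; apply/rowP => i; apply: Some_inj; rewrite -!pt_rshift.
by rewrite -[rshift 3 i](permKV s) -flft_pt // e fz.
Qed.

Lemma gmap_comp s t : gmap t \o gmap s = gmap (R := R) (s * t)%g.
Proof.
apply/funext => l /=; have [hl|nl] := pselect (Kn l); last first.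
  have nl' : (l \in @Kn R k) = false by apply/negP => /set_mem.
  by rewrite /gmap !nl'.
have hl' := gmap_Kn s hl.
have [|i|_ ->//] := @gmap_unique l (gmap t (gmap s l)) (s * t)%g
    (flft (gmap s l) t \o flft l s) hl.
  by apply: is_lft_comp; apply: is_lft_flft.
by rewrite /= !flft_pt // permM.
Qed.

Lemma gmap_iter s e : gmap (R := R) (s ^+ e)%g = iter e (gmap s).
Proof.
elim: e => [|e IH].
  apply/funext => l /=; have [hl|nl] := pselect (Kn l); last first.
    by rewrite /gmap; case: ifP => // /set_mem.
  by case: (@gmap_unique l l 1%g id hl (is_lft_id R)) => // i; rewrite perm1.
by rewrite expgSr -gmap_comp IH.
Qed.

Lemma flft_expg l s e : Kn l -> gmap s l = l ->
  flft l (s ^+ e)%g = iter e (flft l s) /\ gmap (s ^+ e)%g l = l.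
Proof.
move=> hl sl; apply: gmap_unique => //.
  elim: e => [|e IH]; first exact: is_lft_id.
  exact: (is_lft_comp (is_lft_flft s hl) IH).
move=> i; elim: e => [|e IH]; first by rewrite perm1.
by rewrite iterS IH expgSr permM flft_pt // sl.
Qed.

End Configuration.

(** * The derivative of g_s *)

Section Differentials.
Variables (K : numFieldType) (V W : normedModType K).

(** The maps g_s are given by their cross-ratio formula only near l. *)
Lemma near_eq_differentiable (f g : V -> W) x :
  {near x, f =1 g} -> differentiable f x ->
  differentiable g x /\ 'd g x = 'd f x :> (V -> W).
Proof.
move=> fg df; have fgx : f x = g x by apply: nbhs_singleton fg.
suff h : g \o shift x = cst (g x) + 'd f x +o_ 0 id.
  have e : 'd g x = 'd f x :> (V -> W).
    by apply: diff_unique => //; apply: diff_continuous.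
  split=> //; apply/diff_locallyP; rewrite e; split=> //.
  exact: diff_continuous.
have /eqaddoP := diff_locally df; rewrite fgx => fo.
have fg0 : \forall h \near (0 : V), f (h + x) = g (h + x).
  have : \forall z \near x, f z = g z by exact: fg.
  by rewrite (near_shift 0) subr0.
apply/eqaddoP => e e0; near=> h.
have -> : (g \o shift x - (cst (g x) + 'd f x)) h =
          (f \o shift x - (cst (g x) + 'd f x)) h.
  rewrite !fctE /=; congr (_ - _); near: h.
  by apply: filterS fg0 => h ->.
by near: h; exact: fo.
Unshelve. all: by end_near.
Qed.

Variable x : V.
Implicit Types (X A B D P Q : V -> K).

(** Both uses of the product rule below have this form: the numerators and
    denominators of the cross-ratios, and the equation that they satisfy. *)
Lemma diff_mul_affine A B D (y : K) d :
  differentiable A x -> differentiable B x -> differentiable D x ->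
  differentiable (fun z => A z * B z + D z * y) x /\
  'd (fun z => A z * B z + D z * y) x d =
  'd A x d * B x + A x * 'd B x d + 'd D x d * y.
Proof.
move=> dA dB dD.
have h : is_diff x (A * B + D * cst y)
   ((A x *: ('d B x : V -> K) + B x *: ('d A x : V -> K))
    + (D x *: 0 + cst y x *: ('d D x : V -> K))).
  apply: is_diffD; apply: is_diffM; exact/differentiableP.
case: h => dh eh; split=> //.
transitivity ((A x *: ('d B x : V -> K) + B x *: ('d A x : V -> K)
    + (D x *: 0 + cst y x *: ('d D x : V -> K))) d).
  exact: (congr1 (fun F : V -> K => F d) eh).
move: (A x) (B x) (D x) ('d A x : V -> K) ('d B x : V -> K) ('d D x : V -> K).
move=> a b e a' b' e'; rewrite -[LHS]/(a * b' d + b * a' d + (e * 0 + y * e' d)).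
by ring.
Qed.

End Differentials.

Section Tangent.
Variables (C : numFieldType) (k : nat).
Implicit Types (l d : 'rV[C]_k) (s : 'S_(3 + k)).

(** The first coordinate of the displacement of [vec l i] when l is displaced by d;
    the second coordinate of [vec l i] is constant. *)
Definition dvec d (i : 'I_(3 + k)) : C :=
  if fintype.split i is inr j then d 0 j else 0.

Lemma dvec_lshift d i : dvec d (lshift k i) = 0.
Proof. by rewrite /dvec (unsplitK (inl i)). Qed.

Lemma dvec_rshift d i : dvec d (rshift 3 i) = d 0 i.
Proof. by rewrite /dvec (unsplitK (inr i)). Qed.

Lemma vec2E l l' i : (vec l i).2 = (vec l' i).2.
Proof. by case: (split_ordP i) => j ->; rewrite ?vec_lshift ?vec_rshift. Qed.

Lemma diff_coord n (x d : 'rV[C]_n) (j : 'I_n) :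
  'd (fun z : 'rV[C]_n => z 0 j : C) x d = d 0 j.
Proof.
have flin : linear (fun z : 'rV[C]_n => z 0 j : C) by move=> a u v; rewrite !mxE.
pose fM := GRing.isLinear.Build _ _ _ _ _ flin.
pose fL : {linear 'rV[C]_n -> C} := HB.pack (fun z : 'rV[C]_n => z 0 j : C) fM.
have : 'd fL x = fL :> (_ -> _) by apply: diff_lin; exact: coord_continuous.
by move/(congr1 (fun F : 'rV[C]_n -> C => F d)).
Qed.

Lemma diff_vec1 i l : differentiable (fun z => (vec z i).1) l /\
  forall d, 'd (fun z => (vec z i).1) l d = dvec d i.
Proof.
case: (split_ordP i) => j ->.
  have -> : (fun z => (vec z (lshift k j)).1) = cst (vec l (lshift k j)).1.
    by apply/funext => z; rewrite !vec_lshift.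
  by split=> [|d]; rewrite ?diff_cst ?dvec_lshift //; exact: differentiable_cst.
have -> : (fun z => (vec z (rshift 3 j)).1) = (fun z : 'rV[C]_k => z 0 j : C).
  by apply/funext => z; rewrite !vec_rshift.
split=> [|d]; first exact: differentiable_coord.
by rewrite diff_coord dvec_rshift.
Qed.

Lemma differentiable_vec2 i l : differentiable (fun z => (vec z i).2) l.
Proof.
have -> : (fun z => (vec z i).2) = cst (vec l i).2.
  by apply/funext => z; exact: vec2E.
exact: differentiable_cst.
Qed.

Lemma differentiable_br a b l : differentiable (fun z => br (vec z a) (vec z b)) l.
Proof.
have h i := (diff_vec1 i l).1; have h2 i := differentiable_vec2 i l.
by apply: differentiableB; apply: differentiableM.
Qed.

Lemma differentiable_flft_mx s i j l : differentiable (fun z => flft_mx z s i j) l.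
Proof.
have h a := (diff_vec1 a l).1; have h2 a := differentiable_vec2 a l.
have h3 a b := differentiable_br a b l.
have -> : (fun z => flft_mx z s i j) = fun z : 'rV[C]_k =>
  nth (0 : C) (nth [::]
    (let v0 := vec z ((s^-1)%g (lshift k 0)) in
     let v1 := vec z ((s^-1)%g (lshift k 1)) in
     let v2 := vec z ((s^-1)%g (lshift k 2)) in
     [:: [:: v0.2 * br v1 v2; - v0.1 * br v1 v2];
         [:: v2.2 * br v1 v0; - v2.1 * br v1 v0]]) i) j.
  by apply/funext => z; rewrite mxE.
case: i j => -[|[|//]] ? [[|[|//]] ?] /=; apply: differentiableM => //;
  exact: differentiableN.
Qed.

(** The condition of [Kn] over an arbitrary normed field C; the computation of the
    derivatives is the same over all of them. *)
Definition distinct l : Prop :=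
  (forall i, l 0 i != 0 /\ l 0 i != 1) /\ (forall i j, i != j -> l 0 i != l 0 j).

Lemma near_distinct l : distinct l -> \forall z \near l, distinct z.
Proof.
move=> [l01 ll]; pose FF := nbhs_filter l.
have coordC i : (fun z : 'rV[C]_k => z 0 i) @ l --> l 0 i by apply: coord_continuous.
have h1 : \forall z \near l, forall i, (z : 'rV[C]_k) 0 i != 0 /\ z 0 i != 1.
  apply: (filter_forall (f := fun i (z : 'rV[C]_k) => z 0 i != 0 /\ z 0 i != 1) FF).
  move=> i; have [n0 n1] := l01 i.
  have a0 := cvgr_neq0 (FF := FF) (l 0 i) (coordC i) n0.
  have a1 := cvgr_neq0 (FF := FF) (l 0 i - 1) (cvgB (coordC i) (cvg_cst _)).
  have a2 := a1 FF FF; rewrite subr_eq0 n1 in a2.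
  by apply: filterS2 a0 (a2 isT) => z z0; rewrite subr_eq0.
have h2 : \forall z \near l, forall i j, i != j -> (z : 'rV[C]_k) 0 i != z 0 j.
  apply: (filter_forall (f := fun i (z : 'rV[C]_k) =>
    forall j, i != j -> z 0 i != z 0 j) FF) => i.
  apply: (filter_forall (f := fun j (z : 'rV[C]_k) => i != j -> z 0 i != z 0 j) FF) => j.
  case: (boolP (i == j)) => nij; first exact: filterE.
  have a := cvgr_neq0 (FF := FF) (l 0 i - l 0 j) (cvgB (coordC i) (coordC j)).
  have a2 := a FF; rewrite subr_eq0 ll // in a2.
  by apply: filterS (a2 isT) => z; rewrite subr_eq0.
exact: filterS2 h1 h2.
Qed.

(** The two homogeneous coordinates of the image of the point a under f_s, as
    functions of the configuration. *)
Definition num s (a : 'I_(3 + k)) : 'rV[C]_k -> C :=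
  fun z => flft_mx z s 0 0 * (vec z a).1 + flft_mx z s 0 1 * (vec z a).2.
Definition dnm s (a : 'I_(3 + k)) : 'rV[C]_k -> C :=
  fun z => flft_mx z s 1 0 * (vec z a).1 + flft_mx z s 1 1 * (vec z a).2.

Definition dflft_mx l s d : 'M[C]_2 :=
  \matrix_(i, j) 'd (fun z => flft_mx z s i j) l d.

Lemma diff_num s a l : differentiable (num s a) l /\ forall d,
  'd (num s a) l d = (lin (dflft_mx l s d) (vec l a)).1
                     + (lin (flft_mx l s) (dvec d a, 0)).1.
Proof.
have [h hd] := diff_vec1 a l; have F i j := differentiable_flft_mx s i j l.
have -> : num s a = fun z => flft_mx z s 0 0 * (vec z a).1 + flft_mx z s 0 1 * (vec l a).2.
  by apply/funext => z; rewrite /num (vec2E z l).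
split=> [|d]; first by have [] := diff_mul_affine (vec l a).2 0 (F 0 0) h (F 0 1).
have [_ ->] := diff_mul_affine (vec l a).2 d (F 0 0) h (F 0 1).
by rewrite hd /lin !mxE /= mulr0 addr0 addrAC.
Qed.

Lemma diff_dnm s a l : differentiable (dnm s a) l /\ forall d,
  'd (dnm s a) l d = (lin (dflft_mx l s d) (vec l a)).2
                     + (lin (flft_mx l s) (dvec d a, 0)).2.
Proof.
have [h hd] := diff_vec1 a l; have F i j := differentiable_flft_mx s i j l.
have -> : dnm s a = fun z => flft_mx z s 1 0 * (vec z a).1 + flft_mx z s 1 1 * (vec l a).2.
  by apply/funext => z; rewrite /dnm (vec2E z l).
split=> [|d]; first by have [] := diff_mul_affine (vec l a).2 0 (F 1 0) h (F 1 1).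
have [_ ->] := diff_mul_affine (vec l a).2 d (F 1 0) h (F 1 1).
by rewrite hd /lin !mxE /= mulr0 addr0 addrAC.
Qed.

Section SelfMap.
Variables (g : 'rV[C]_k -> 'rV[C]_k) (s : 'S_(3 + k)) (l : 'rV[C]_k).
Hypothesis hl : distinct l.
Hypothesis g_quotient : forall z, distinct z -> forall i,
  dnm s ((s^-1)%g (rshift 3 i)) z != 0 /\
  g z 0 i = num s ((s^-1)%g (rshift 3 i)) z / dnm s ((s^-1)%g (rshift 3 i)) z.
Hypothesis g_br : forall z, distinct z -> forall a,
  br (vec (g z) (s a)) (lin (flft_mx z s) (vec z a)) = 0.

Lemma differentiable_quotient : differentiable g l.
Proof.
pose a i := (s^-1)%g (rshift 3 i : 'I_(3 + k)).
pose f i z : 'rV[C]_k := (num s (a i) z * (dnm s (a i) z)^-1) *: delta_mx 0 i.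
have df : differentiable (\sum_i f i) l.
  apply: differentiable_sum => i; apply: differentiableZl.
  apply: differentiableM; first exact: (diff_num _ _ _).1.
  by apply: differentiableV; [exact: (diff_dnm _ _ _).1|case: (g_quotient hl i)].
apply: (near_eq_differentiable _ df).1.
apply: filterS (near_distinct hl) => z hz; rewrite fct_sumE.
rewrite [RHS]row_sum_delta; apply: eq_bigr => i _.
by rewrite /f; congr (_ *: _); case: (g_quotient hz i).
Qed.

(** Derivative at l of the identity g_br, for a map g that fixes l; it expresses
    the velocity of the points of g(z) through the velocities of the points of
    z and of the matrix of f_s. *)
Lemma diff_relation d a (e := d *m jacobian g l) : g l = l ->
  br (dvec e (s a), 0) (lin (flft_mx l s) (vec l a)) +
  br (vec l (s a)) (lin (dflft_mx l s d) (vec l a)) +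
  br (vec l (s a)) (lin (flft_mx l s) (dvec d a, 0)) = 0.
Proof.
move=> gl; pose y := (vec l (s a)).2.
pose X z := (vec (g z) (s a)).1.
have dg := differentiable_quotient.
have [dx dxE] := diff_vec1 (s a) l.
have XE : X = (fun z => (vec z (s a)).1) \o g by [].
have dx' : differentiable (fun z => (vec z (s a)).1) (g l) by rewrite gl.
have dX : differentiable X l by rewrite XE; apply: differentiable_comp.
have dXE : 'd X l d = dvec e (s a).
  rewrite /e /jacobian mul_rV_lin1.
  have := diff_comp dg dx'; rewrite -XE => /(congr1 (fun F : _ -> C => F d)) -> /=.
  by rewrite gl dxE.
have [dP dPE] := diff_num s a l; have [dQ dQE] := diff_dnm s a l.
have [dPhi PhiE] := diff_mul_affine (- y) d dX dQ dP.
(* This is g_br written out; its derivative at l is PhiE. *)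
have near0 : {near l, (fun z => X z * dnm s a z + num s a z * - y) =1 cst 0}.
  apply: filterS (near_distinct hl) => z hz /=.
  rewrite -[RHS](g_br hz a) /br /= -/(num s a z) -/(dnm s a z).
  by rewrite (vec2E (g z) l) -/y -/(X z); ring.
have [_ e0] := near_eq_differentiable near0 dPhi.
have := congr1 (fun F : _ -> C => F d) e0.
rewrite diff_cst PhiE dXE dPE dQE.
have -> : X l = (vec l (s a)).1 by rewrite /X gl.
move=> h; rewrite -[RHS]/((0 : 'rV[C]_k -> C) d) h /num /dnm /br /y /lin /=; ring.
Qed.

End SelfMap.

(** The value of [br (vec l i) dv] for the displacement dv of [vec l i]. *)
Definition tang d (i : 'I_(3 + k)) : C :=
  if fintype.split i is inr j then - d 0 j else 0.

Lemma tang_lshift d i : tang d (lshift k i) = 0.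
Proof. by rewrite /tang (unsplitK (inl i)). Qed.

Lemma tang_rshift d i : tang d (rshift 3 i) = - d 0 i.
Proof. by rewrite /tang (unsplitK (inr i)). Qed.

Lemma br_tang l d i : br (vec l i) (dvec d i, 0) = tang d i.
Proof.
case: (split_ordP i) => j ->; rewrite ?vec_lshift ?vec_rshift.
  by rewrite dvec_lshift tang_lshift /br /= mulr0 mul0r subrr.
by rewrite dvec_rshift tang_rshift /br /= mulr0 mulr1 sub0r.
Qed.

End Tangent.

Section GmapTangent.
Variables (R : realType) (k : nat).
Local Notation C := R[i].
Implicit Types (l d : 'rV[C]_k) (s : 'S_(3 + k)).

Lemma hpoint_gmap l s a : Kn l ->
  hpoint (lin (flft_mx l s) (vec l a)) = hpoint (vec (gmap s l) (s a)).
Proof.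
by move=> hl; rewrite -moebius_hpoint ?vec_neq0 // !hpoint_vec -flftE // flft_pt.
Qed.

Lemma lin_flft_neq0 l s a : Kn l -> lin (flft_mx l s) (vec l a) != (0, 0).
Proof. by move=> hl; rewrite lin_neq0 ?vec_neq0 ?det_flft_mx. Qed.

Lemma gmap_quotient l s i (a := (s^-1)%g (rshift 3 i)) : Kn l ->
  dnm s a l != 0 /\ gmap s l 0 i = num s a l / dnm s a l.
Proof.
move=> hl; have := hpoint_gmap s a hl; rewrite permKV vec_rshift /hpoint /= oner_eq0 divr1.
rewrite -/(num s a l) -/(dnm s a l).
by case: ifP => // /negbT d0 [].
Qed.

Lemma gmap_br l s a : Kn l ->
  br (vec (gmap s l) (s a)) (lin (flft_mx l s) (vec l a)) = 0.
Proof.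
move=> hl; apply/eqP; rewrite -hpoint_br ?vec_neq0 ?lin_flft_neq0 //.
by apply/eqP; rewrite hpoint_gmap.
Qed.

(** The derivative of g_s at a fixed point l is the action of f_s on tangent
    vectors, up to the vector field given by the derivative E of the matrix
    of f_s; these are the hypotheses of [pairing_push]. *)
Lemma gmap_tangent l s : Kn l -> gmap s l = l ->
  exists2 c : 'I_(3 + k) -> C, forall a, c a != 0 &
  (forall a, lin (flft_mx l s) (vec l a) = scalev (c a) (vec l (s a))) /\
  exists E : 'rV[C]_k -> 'M[C]_2, forall d a,
    c a ^+ 2 * tang (d *m jacobian (gmap s) l) (s a) =
      \det (flft_mx l s) * tang d a +
      br (lin (flft_mx l s) (vec l a)) (lin (E d) (vec l a)).
Proof.
move=> hl sl.
have /fin_all_exists2 [c c0 cE] a : exists2 x : C, x != 0 &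
    lin (flft_mx l s) (vec l a) = scalev x (vec l (s a)).
  by apply: hpoint_eq_scale; rewrite ?lin_flft_neq0 ?vec_neq0 // hpoint_gmap // sl.
exists c => //; split=> //; exists (dflft_mx l s) => d a.
have quot z (hz : distinct z) i := gmap_quotient s i (hz : Kn z).
have brs z (hz : distinct z) a := gmap_br s a (hz : Kn z).
have := diff_relation (hl : distinct l) quot brs d a sl.
move: (d *m jacobian _ _) => e.
rewrite -!(br_tang l) -br_lin !cE.
move: (lin (dflft_mx l s d) _) (lin _ (dvec d a, 0)) (vec l (s a)) (c a) => E F v x.
set f := (dvec _ _, 0); rewrite !brZl brZr (br_anti f) => h.
apply/eqP; rewrite -subr_eq0; apply/eqP.
by rewrite -[RHS](mulr0 (- x)) -h; ring.
Qed.

End GmapTangent.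

(** * Roots of unity *)

Section Roots.
Variable R : realType.
Local Notation w := (wroot R).

Lemma expiD (x y : R) : expi (x + y) = expi x * expi y.
Proof.
by rewrite /expi cosD sinD; apply/eqP; rewrite eq_complex /= eqxx /= addrC.
Qed.

Lemma expi0 : expi (0 : R) = 1.
Proof. by rewrite /expi cos0 sin0. Qed.

Lemma expiX (x : R) n : expi x ^+ n = expi (x *+ n).
Proof. by elim: n => [|n IH]; rewrite ?expi0 // exprS IH mulrS expiD. Qed.

Lemma expi_2pi : expi (2 * pi : R) = 1.
Proof. by rewrite /expi mulr_natl cos2pi sin2pi. Qed.

Lemma expi_int (z : int) : expi (z%:~R * (2 * pi) : R) = 1.
Proof.
case: z => n; first by rewrite -pmulrn [X in expi X]mulr_natl -expiX expi_2pi expr1n.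
have e : expi (n.+1%:~R * (2 * pi) : R) = 1.
  by rewrite -pmulrn [X in expi X]mulr_natl -expiX expi_2pi expr1n.
rewrite NegzE mulrNz mulNr.
by have := expiD (- (n.+1%:~R * (2 * pi))) (n.+1%:~R * (2 * pi) : R);
  rewrite addNr expi0 e mulr1 => <-.
Qed.

(** By the half-angle formula, cos x = 1 would give sin (x / 2) = 0, but x / 2 lies
    strictly between 0 and pi. *)
Lemma expi_neq1 (x : R) : 0 < x < 2 * pi -> expi x != 1.
Proof.
move=> /andP [x0 x2]; apply/eqP => -[/eqP cx _]; move: cx.
rewrite -[x](divfK (x := 2)) ?pnatr_eq0 // mulr_natr cos_mulr2n cos2sin2.
have s0 : 0 < sin (x / 2).
  by apply: sin_gt0_pi; rewrite divr_gt0 //= ltr_pdivrMr // mulrC.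
have s2 : 0 < sin (x / 2) ^+ 2 by rewrite exprn_gt0.
by apply/negP; rewrite lt_eqF //; lra.
Qed.

Lemma wroot_prim p : (0 < p)%N -> p.-primitive_root (w p).
Proof.
move=> p0; have pR : 0 < p%:R :> R by rewrite ltr0n.
have wX j : w p ^+ j = expi (2 * pi / p%:R *+ j) by rewrite expiX.
have wp : w p ^+ p = 1.
  by rewrite wX -mulr_natr divfK ?expi_2pi // gt_eqF.
have [m m_prim /dvdn_leq-/(_ p0)] := prim_order_exists p0 wp.
rewrite leq_eqVlt => /predU1P [e|mp]; first by rewrite -{1}e.
have m0 := prim_order_gt0 m_prim.
have /eqP := prim_expr_order m_prim; rewrite wX.
rewrite (negbTE (expi_neq1 _)) //.
have := pi_gt0 R => pi0.
have t0 : 0 < 2 * pi :> R by rewrite mulr_gt0.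
rewrite -mulr_natr mulrAC; apply/andP; split.
  by rewrite divr_gt0 // mulr_gt0 // ltr0n.
by rewrite ltr_pdivrMr // (ltr_pM2l t0) ltr_nat.
Qed.

Lemma wroot_neq0 p : (0 < p)%N -> w p != 0.
Proof.
move=> p0; apply/eqP => w0; have /eqP := prim_expr_order (wroot_prim p0).
by rewrite w0 expr0n gtn_eqF // eq_sym oner_eq0.
Qed.

(** Every expi (y / p * 2 pi) is a p-th root of unity, hence one of the first p powers
    of the primitive root. *)
Lemma CpP p z x : (0 < p)%N -> Cp p z x <-> exists e : 'I_p, x = w p ^+ e * z.
Proof.
move=> p0; have pR : p%:R != 0 :> R by rewrite pnatr_eq0 -lt0n.
split=> [[y _ <-]|[e ->]].
  have : expi (y%:~R / p%:R * (2 * pi) : R) ^+ p = 1.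
    rewrite expiX -[X in expi X]mulr_natr.
    rewrite (_ : _ * p%:R = y%:~R * (2 * pi)) ?expi_int //; field; exact: pR.
  by case/(prim_rootP (wroot_prim p0)) => e ->; exists e.
exists e%:Z => //; congr (_ * _); rewrite expiX; congr expi.
by rewrite -[RHS]mulr_natl -pmulrn; field.
Qed.

End Roots.

(** * Counting residues and grouping an eigenbasis by characters *)

(** Each full period of length p contributes 1, and the last one contributes 1
    exactly if it reaches j. *)
Lemma count_mod p m r j : (j < p)%N -> (r <= p)%N ->
  (\sum_(v < m * p + r) (v %% p == j) = m + (j < r))%N.
Proof.
move=> jp; have p0 : (0 < p)%N by apply: leq_ltn_trans jp.
elim: m r => [|m IHm]; elim=> [|r IHr] rp; rewrite ?addn0.
- by rewrite mul0n big_ord0.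
- by rewrite addnS big_ord_recr IHr ?(ltnW rp) //= mul0n !add0n modn_small // ltnS; lia.
- by rewrite mulSn addnC IHm // jp addn1.
rewrite addnS big_ord_recr IHr ?(ltnW rp) //= modnMDl modn_small // ltnS; lia.
Qed.

Section Counts.
Variables (k p m : nat).
Hypotheses (p2 : (2 <= p)%N) (m0 : (0 < m)%N).

(** The exponents i + 2 for i < m p - 3 run through m full periods from which the
    residues p - 1, 0 and 1 have been removed once each.  The index j stands for
    the character X^(j+1). *)
Lemma count_mC j : (3 + k = m * p)%N -> (j < p)%N ->
  (\sum_(i < k) ((i + 1 - 0) %% p == j) = m - 1 + (j < p - 2) - (j == 0))%N.
Proof.
move=> e jp; have ek : ((m - 1) * p + (p - 2) = k.+1)%N by nia.
have := count_mod (m - 1) jp (leq_subr 2 p).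
rewrite ek big_ord_recl /= mod0n eq_sym => <-; rewrite addKn.
by apply: eq_bigr => i _; rewrite subn0 addn1.
Qed.

Lemma count_1mC j : (3 + k = m * p + 1)%N -> (j < p)%N ->
  (\sum_(i < k) ((i + 1 - 1) %% p == j) = m - 1 + (j < p - 2))%N.
Proof.
move=> e jp; have ek : ((m - 1) * p + (p - 2) = k)%N by nia.
have := count_mod (m - 1) jp (leq_subr 2 p); rewrite ek => <-.
by apply: eq_bigr => i _; rewrite addnK.
Qed.

Lemma count_2mC j : (3 + k = m * p + 2)%N -> (j < p)%N ->
  (\sum_(i < k) ((i + 1 - 1) %% p == j) = m - 1 + (j < p - 1))%N.
Proof.
move=> e jp; have ek : ((m - 1) * p + (p - 1) = k)%N by nia.
have := count_mod (m - 1) jp (leq_subr 1 p); rewrite ek => <-.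
by apply: eq_bigr => i _; rewrite addnK.
Qed.

End Counts.

Section LinearAlgebra.
Variables (F : fieldType) (k p : nat).

(** The blocks of a direct sum are numbered consecutively; phi lists the fibers of
    kap in this order. *)
Lemma card_fibers (kap : 'I_k -> 'I_p) (a : seq nat) :
  (forall j : 'I_p, nth 0%N a j = #|[pred i | kap i == j]|) ->
  exists phi : 'I_(\sum_(j < p) nth 0%N a j) -> 'I_k,
    bijective phi /\ forall u, kap (phi u) = tagnat.sig1 u.
Proof.
move=> aE.
pose phi (u : 'I_(\sum_(j < p) nth 0%N a j)) : 'I_k :=
  enum_val (cast_ord (aE (tagnat.sig1 u)) (tagnat.sig2 u)).
have kphi u : kap (phi u) = tagnat.sig1 u.
  by have := enum_valP (cast_ord (aE (tagnat.sig1 u)) (tagnat.sig2 u)); rewrite inE => /eqP.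
exists phi; split=> //; apply: inj_card_bij.
  move=> u u' e; have e1 : tagnat.sig1 u = tagnat.sig1 u' by rewrite -!kphi e.
  rewrite -[u]tagnat.sig2K -[u']tagnat.sig2K; move: e; rewrite /phi.
  move: (tagnat.sig1 u) (tagnat.sig1 u') e1 (tagnat.sig2 u) (tagnat.sig2 u').
  by move=> j j' <- x y /enum_val_inj /cast_ord_inj ->.
rewrite !card_ord (eq_bigr _ (fun j _ => aE j)).
rewrite (eq_bigr (fun j => \sum_(i | kap i == j) 1)%N) => [|j _]; last first.
  by rewrite -sum1_card; apply: eq_bigl => i; rewrite inE.
have <- : (\sum_(i < k) 1 = \sum_j \sum_(i | kap i == j) 1)%N.
  exact: (partition_big kap xpredT).
by rewrite sum1_card card_ord.
Qed.

(** The columns of W are linear functionals that J, acting on row vectors on the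
    right, multiplies by scalars.  The columns of the inverse of the transpose
    of W are then eigenvectors of the transpose of J; P lists them by
    character. *)
Lemma block_diagonalize (W : 'M[F]_k) (kap : 'I_k -> 'I_p) (a : seq nat) :
  W \in unitmx ->
  (forall j : 'I_p, nth 0%N a j = #|[pred i | kap i == j]|) ->
  exists (P : 'M[F]_(k, \sum_(j < p) nth 0%N a j))
         (Q : 'M[F]_(\sum_(j < p) nth 0%N a j, k)),
  [/\ P *m Q = 1%:M, Q *m P = 1%:M &
     forall (J : 'M[F]_k) (x : 'I_p -> F),
       J *m W = W *m diag_mx (\row_i x (kap i)) ->
       J^T *m P = P *m \mxdiag_(j < p) ((x j)%:M : 'M[F]_(nth 0%N a j))].
Proof.
move=> uW /card_fibers [phi [bphi kphi]].
have uWT : W^T \in unitmx by rewrite unitmx_tr.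
pose V := invmx W^T.
exists (colsub phi V), (rowsub phi W^T); split.
- apply/matrixP => i j; rewrite -(mulVmx uWT) !mxE.
  rewrite [RHS](reindex phi) /=; last exact: onW_bij.
  by apply: eq_bigr => u _; rewrite !mxE.
- apply/matrixP => u u'; have := congr1 (fun M : 'M[F]_k => M (phi u) (phi u')) (mulmxV uWT).
  rewrite !mxE (inj_eq (bij_inj bphi)) => <-.
  by apply: eq_bigr => i _; rewrite !mxE.
move=> J x JW; have JV : J^T *m V = V *m diag_mx (\row_i x (kap i)).
  apply: (can_inj (mulKmx uWT)); rewrite !mulmxA mulmxV // mul1mx.
  by rewrite -trmx_mul JW trmx_mul tr_diag_mx mulmxK.
apply/matrixP => i u.
transitivity ((J^T *m V) i (phi u)).
  by rewrite !mxE; apply: eq_bigr => r _; rewrite !mxE.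
rewrite JV mul_mx_diag !mxE kphi (bigD1 u) //= [X in _ = _ + X]big1 ?addr0 => [|u' nu].
  by rewrite !mxE eqxx conform_mx_id mxE eqxx.
rewrite !mxE; case: eqVneq => [e1|_]; last by rewrite mxE mulr0.
apply/eqP; rewrite mulf_eq0; apply/orP; right; apply/eqP.
pose rk := @tagnat.Rank p (fun j : 'I_p => nth 0%N a j).
have : rk _ (tagnat.sig2 u') != rk _ (tagnat.sig2 u) by rewrite /rk !tagnat.sig2K.
move: e1 (tagnat.sig2 u') (tagnat.sig2 u).
move: (tagnat.sig1 u') (tagnat.sig1 u) => j j' <- y z nyz.
rewrite conform_mx_id mxE; by case: (eqVneq y z) nyz => [->|//]; rewrite eqxx.
Qed.

End LinearAlgebra.

(** * The stabilizer of a configuration *)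

Section Faithful.
Variables (R : realType) (k : nat).
Local Notation C := R[i].
Implicit Types (l d : 'rV[C]_k) (s t : 'S_(3 + k)).

(** The derivative of g_s pulls a quadratic differential back by f_s, up to a scalar
    that depends on s only. *)
Lemma pairing_gmap l s : Kn l -> gmap s l = l ->
  exists (F : 'M[C]_2) (c : 'I_(3 + k) -> C) (x : C),
  [/\ x != 0, forall a, c a != 0,
    forall a, lin F (vec l a) = scalev (c a) (vec l (s a)) &
    forall hs d, (size hs).+1 = k ->
      pairing (vec l) hs (tang (d *m jacobian (gmap s) l)) =
      x * pairing (vec l) (map (colin F) hs) (tang d)].
Proof.
move=> hl sl; have [c c0 [cE [E EE]]] := gmap_tangent hl sl.
exists (flft_mx l s), c, (\prod_a c a / \det (flft_mx l s) ^+ k.+1); split=> //.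
  by rewrite mulf_neq0 ?invr_eq0 ?expf_neq0 ?det_flft_mx //; apply/prodf_neq0.
move=> hs d szk; have -> : k.+1 = (size hs).+2 by rewrite szk.
have cN : #|'I_(3 + k)| = (size hs).+4 by rewrite card_ord szk.
have v_free a b := @br_vec R k l a b hl.
exact: (pairing_push v_free cN (det_flft_mx s hl) c0 cE (EE d)).
Qed.

Lemma pairing_tang l hs d :
  pairing (vec l) hs (tang d) =
  - \sum_i d 0 i * (bform hs (vec l (rshift 3 i)) / den (vec l) (rshift 3 i)).
Proof.
rewrite /pairing big_split_ord /= big1 ?add0r => [|i _]; last first.
  by rewrite tang_lshift mulr0 mul0r.
by rewrite -sumrN; apply: eq_bigr => i _; rewrite tang_rshift; ring.
Qed.

Lemma pairing_tang_delta l hs i :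
  pairing (vec l) hs (tang (delta_mx 0 i)) =
  - (bform hs (vec l (rshift 3 i)) / den (vec l) (rshift 3 i)).
Proof.
rewrite pairing_tang (bigD1 i) //= big1 ?addr0 => [|j nj].
  by rewrite !mxE !eqxx mul1r.
by rewrite !mxE /= (negbTE nj) mul0r.
Qed.

(** If g_s = g_t then their derivatives agree, so the form G h = x (h o F_s) - y
    (h o F_t) pairs to zero with all tangent vectors; hence it vanishes at the
    points with free coordinates.  To see that it vanishes at one of the three
    normalized points as well, multiply it by the quadratic form that vanishes
    at the other two and apply the residue theorem.  Now choose h to be a power
    of the linear form that vanishes at the point s a: as k > 1, it is a
    positive power, and it has to vanish at the point t a. *)
Lemma gmap_inj_stab l s t : (2 <= k)%N -> Kn l -> gmap s l = l -> gmap t l = l ->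
  gmap s = gmap (R := R) t -> s = t.
Proof.
move=> k2 hl sl tl est; have v_free a b := @br_vec R k l a b hl.
have [Fs [c [x [x0 c0 cE xE]]]] := pairing_gmap hl sl.
have [Ft [c' [y [y0 c0' cE' yE]]]] := pairing_gmap hl tl.
pose G hs a := x * bform hs (lin Fs (vec l a)) - y * bform hs (lin Ft (vec l a)).
have Gr hs i : (size hs).+1 = k -> G hs (rshift 3 i) = 0.
  move=> szk; have e1 := xE hs (delta_mx 0 i) szk; have e2 := yE hs (delta_mx 0 i) szk.
  rewrite est {}e2 pairing_tang_delta in e1.
  rewrite pairing_tang_delta !mulrN -!bform_lin !mulrA in e1.
  have {}e1 := mulIf (invr_neq0 (den_neq0 v_free _)) (oppr_inj e1).
  by rewrite /G e1 subrr.
have Gl hs i : (size hs).+1 = k -> G hs (lshift k i) = 0.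
  (* q is the quadratic form that vanishes at the other two normalized points. *)
  move=> szk; pose q := [seq vec l (lshift k j) | j in predC1 i].
  have szq : size q = 2 by rewrite size_image cardC1 card_ord.
  have q0 j : (bform q (vec l (lshift k j)) != 0) = (j == i).
    rewrite /bform /q big_image /=; case: (eqVneq j i) => [->|nji].
      apply/prodf_neq0 => b; rewrite inE eq_sym => nb; apply: v_free.
      by rewrite (inj_eq (@lshift_inj _ _)).
    by apply/negbF/prodf_eq0; exists j; rewrite ?inE // brvv.
  have res F : \sum_a bform (map (colin F) hs ++ q) (vec l a) / den (vec l) a = 0.
    by apply: sum_residues => //; rewrite size_cat size_map szq card_ord -szk addn2.
  have : \sum_a G hs a * bform q (vec l a) / den (vec l) a = 0.
    pose r F := \sum_a bform (map (colin F) hs ++ q) (vec l a) / den (vec l) a.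
    transitivity (x * r Fs - y * r Ft); last by rewrite /r !res !mulr0 subrr.
    rewrite /r !mulr_sumr -sumrB; apply: eq_bigr => a _.
    rewrite !bform_cat -!bform_lin /G; ring.
  rewrite (bigD1 (lshift k i)) //= big1 ?addr0 => [/eqP|a na].
    rewrite !mulf_eq0 invr_eq0 (negbTE (den_neq0 v_free _)) orbF.
    by rewrite (negbTE (_ : bform q _ != 0)) ?q0 // orbF => /eqP.
  case: (split_ordP a) na => j -> nj; last by rewrite Gr // !mul0r.
  have /negbFE/eqP -> : (bform q (vec l (lshift k j)) != 0) = false.
    by rewrite q0; rewrite (inj_eq (@lshift_inj _ _)) in nj; apply: negbTE.
  by rewrite mulr0 mul0r.
have G0 hs a : (size hs).+1 = k -> G hs a = 0.
  by case: (split_ordP a) => j -> szk; [apply: Gl|apply: Gr].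
apply/permP => a; apply/eqP; apply: contraT => nst.
pose hs := nseq k.-1 (vec l (s a)).
have szk : (size hs).+1 = k by rewrite size_nseq prednK // (leq_trans _ k2).
have := G0 hs a szk; rewrite /G cE cE' !bformZ /bform /hs !big_nseq !iter_mulr_1 brvv.
have -> : (0 : C) ^+ k.-1 = 0 by rewrite expr0n gtn_eqF // -subn1 subn_gt0.
rewrite !mulr0 sub0r => /eqP; rewrite oppr_eq0 !mulf_eq0 (negbTE y0) !expf_eq0.
rewrite (negbTE (c0' a)) andbF /= => /andP [_].
by rewrite (negbTE (v_free _ _ _)) // eq_sym.
Qed.

End Faithful.

Section Stabilizer.
Variables (R : realType) (k p : nat) (l : 'rV[R[i]]_k).
Local Notation C := R[i].
Local Notation sphere := (option C).
Local Notation w := (wroot R p).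
Hypotheses (k2 : (2 <= k)%N) (p2 : (2 <= p)%N) (hl : Kn l).
Hypothesis hG : stab_isog_Zp l p.
Implicit Types (s t : 'S_(3 + k)) (f psi : sphere -> sphere).

Let p0 : (0 < p)%N. Proof. exact: leq_trans p2. Qed.
Let w_prim : p.-primitive_root w. Proof. exact: wroot_prim. Qed.

Lemma wX_neq0 e : w ^+ e != 0.
Proof. by rewrite expf_neq0 // wroot_neq0. Qed.

Lemma conjugated_iter psi f (q : C) e : conjugated_by psi f (scaling q) ->
  conjugated_by psi (iter e f) (scaling (q ^+ e)).
Proof.
rewrite /conjugated_by => h; elim: e => [|e IH]; apply/funext => z /=.
  by case: (psi z) => //= x; rewrite mul1r.
have /= <- := congr1 (fun F => F (iter e f z)) h.
have /= <- := congr1 (fun F => F z) IH.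
by case: (psi z) => //= x; rewrite exprS mulrA.
Qed.

Lemma scaling_inj : injective (@scaling R).
Proof. by move=> a b /(congr1 (fun F => F (Some 1))) /=; rewrite !mulr1 => -[]. Qed.

Lemma conjugated_surj psi f h h' : is_lft psi ->
  conjugated_by psi f h -> conjugated_by psi f h' -> h = h'.
Proof.
move=> /is_lft_inv [phi [_ _ phiK]] h1 h2; apply/funext => z; rewrite -[z]phiK.
by have := congr1 (fun F => F (phi z)) h1; have := congr1 (fun F => F (phi z)) h2 => /= <-.
Qed.

(** The fixed points of a rotation other than the identity are 0 and infinity. *)
Lemma conjugated_fix psi f (q : C) z : is_lft psi -> q != 1 ->
  conjugated_by psi f (scaling q) -> (f z == z) = (psi z \in [:: Some 0; None]).
Proof.
move=> lp q1 h; rewrite -(inj_eq (is_lft_inj lp)).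
have /= <- := congr1 (fun F => F z) h.
rewrite !inE; case: (psi z) => [x|] //=; rewrite orbF !(inj_eq Some_inj).
by rewrite -subr_eq0 -{2}[x]mul1r -mulrBl mulf_eq0 subr_eq0 (negbTE q1).
Qed.

(** The first p powers of s are distinct, because they are conjugate to distinct
    rotations, and by [gmap_inj_stab] the stabilizer has only p elements. *)
Lemma stab_generated psi s t : is_lft psi -> gmap s l = l ->
  conjugated_by psi (flft l s) (scaling w) -> gmap t l = l ->
  exists e : 'I_p, t = (s ^+ e)%g.
Proof.
move=> lp sl hs tl; case: hG => h [_ h_range _].
have /fin_all_exists [phi phiP] (a : 'Z_p) : exists u, gmap u l = l /\ gmap u = h a.
  have : stab l (h a) by rewrite -h_range; exists a.
  by case=> -[u _ <-] ul; exists u.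
have hT u : gmap u l = l -> exists a, u = phi a.
  move=> ul; have : stab l (gmap u) by split=> //; exists u.
  rewrite -h_range => -[a _ ha]; exists a; have [pl pE] := phiP a.
  by apply: (gmap_inj_stab k2 hl ul pl); rewrite pE.
pose pw (e : 'I_p) := (s ^+ e)%g.
(* Equal powers of s would give equal powers of the primitive root w. *)
have pw_inj : injective pw.
  move=> e e' ee.
  have [fe _] := flft_expg e hl sl; have [fe' _] := flft_expg e' hl sl.
  have ce := conjugated_iter e hs; have ce' := conjugated_iter e' hs.
  rewrite -fe -/(pw e) ee {}fe' in ce.
  have /scaling_inj/eqP := conjugated_surj lp ce ce'.
  by rewrite (eq_prim_root_expr w_prim) !modn_small // => /eqP/val_inj.
have sub : [set pw e | e in 'I_p]%SET \subset [set phi a | a in {: 'Z_p}]%SET.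
  apply/fintype.subsetP => _ /finset.imsetP [e _ ->]; have [_ el] := flft_expg e hl sl.
  by rewrite /pw; have [a ->] := hT _ el; apply: finset.imset_f.
have /eqP eT : [set pw e | e in 'I_p]%SET == [set phi a | a in {: 'Z_p}]%SET.
  rewrite eqEcard sub (card_imset _ pw_inj) card_ord.
  apply: leq_trans (leq_imset_card _ _) _.
  by rewrite card_ord Zp_cast.
have [a ta] := hT _ tl.
have : t \in [set phi a | a in {: 'Z_p}]%SET by rewrite ta; apply: imset_f.
by rewrite -eT => /finset.imsetP [e _ ->]; exists e.
Qed.

Lemma stab_iter psi s g : is_lft psi -> gmap s l = l ->
  conjugated_by psi (flft l s) (scaling w) -> stab l g ->
  exists e, g = iter e (gmap s).
Proof.
move=> lp sl hs [[t _ <-] tl]; have [e ->] := stab_generated lp sl hs tl.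
by exists e; rewrite gmap_iter.
Qed.

(** Pairing with the monomials gives functionals that are eigenvectors of the
    Jacobians of all powers of g_s at once.  The type of l enters only through
    the number e0, which is determined by the
    number of marked points and by whether psi sends one of them to
    infinity. *)
Lemma jac_decomposition_of psi s (m e0 : nat) (a : seq nat) :
  is_lft psi -> gmap s l = l -> conjugated_by psi (flft l s) (scaling w) ->
  (e0 <= 1)%N -> (3 + k = m * p + e0 + #|[pred b | psi (pt l b) == None]|)%N ->
  size a = p ->
  (forall j, (j < p)%N -> nth 0%N a j = \sum_(i < k) ((i + 1 - e0) %% p == j))%N ->
  jac_decomposition l p (gmap s) a.
Proof.
move=> lp sl hs e01 cn sza aE; split=> //.
have [A uA psiE] := lp; have A0 : \det A != 0 by rewrite -unitfE -unitmxE.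
have v_free x y := @br_vec R k l x y hl.
have kK : k.-1.+1 = k by rewrite prednK // (leq_trans _ k2).
(* The monomial of index i has the character of exponent i + 2 - e0, which is
   X^(j+1) for j = i + 1 - e0 modulo p. *)
pose kap (i : 'I_k) : 'I_p := Ordinal (ltn_pmod (i + 1 - e0) p0).
pose hs_ j := map (colin A) (mono C k.-1 j).
pose W : 'M[C]_k := \matrix_(i, j)
  (bform (mono C k.-1 j) (lin A (vec l (rshift 3 i))) * (den (vec l) (rshift 3 i))^-1).
have uW : W \in unitmx.
  apply: mono_unitmx => [i j nij|i]; last by apply/invr_neq0/den_neq0 => x y; exact: br_vec.
  by rewrite br_lin mulf_neq0 // br_vec // (inj_eq (@rshift_inj _ _)).
have aE' (j : 'I_p) : nth 0%N a j = #|[pred i | kap i == j]|.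
  by rewrite aE // -sum1_card [RHS]big_mkcond; apply: eq_bigr => i _; rewrite inE -val_eqE.
have [P [Q [PQ QP H]]] := block_diagonalize uW aE'.
exists P, Q; split=> // g gl.
have /(@xgetPex _ 0%N) : [set e : nat | g = iter e (gmap s)] !=set0.
  by have [e ->] := stab_iter lp sl hs gl; exists e.
rewrite /Xchar; set e := xget _ _ => /= gE.
apply: (H _ (fun j : 'I_p => w ^+ (e * j.+1))); rewrite gE -gmap_iter.
have [fe el] := flft_expg e hl sl; set t := (s ^+ e)%g in fe el *.
have [c c0 [cE [E EE]]] := gmap_tangent hl el.
have conj_e : conjugated_by (moebius A) (moebius (flft_mx l t)) (scaling (w ^+ e)).
  by rewrite -flftE // fe -psiE; apply: conjugated_iter.
have [kappa kappa0 AF] := conjugated_lin A0 (det_flft_mx t hl) (wX_neq0 e) conj_e.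
set J := jacobian _ _.
suff dJ (d : 'rV[C]_k) : d *m (J *m W) =
    d *m (W *m diag_mx (\row_j (w ^+ (e * (kap j).+1)))).
  by apply/row_matrixP => i; rewrite !rowE; apply: dJ.
apply/rowP => j.
have tangW (x : 'rV[C]_k) : (x *m W) 0 j = - pairing (vec l) (hs_ j) (tang x).
  rewrite pairing_tang opprK !mxE; apply: eq_bigr => i _.
  by rewrite mxE /hs_ -bform_lin.
rewrite !mulmxA tangW mul_mx_diag mxE tangW mxE.
have cn' : #|'I_(3 + k)| = (m * p + e0 + #|[pred b | (lin A (vec l b)).2 == 0%R]|)%N.
  transitivity (3 + k)%N; first exact: card_ord.
  rewrite {1}cn; congr (_ + _)%N; apply: eq_card => b; rewrite !inE.
  rewrite psiE -hpoint_vec moebius_hpoint ?vec_neq0 // /hpoint.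
  by case: ifP.
have wep : (w ^+ e) ^+ p = 1 by rewrite exprAC (prim_expr_order w_prim) expr1n.
have jk : (j <= k.-1)%N by rewrite -ltnS kK.
have cN : #|'I_(3 + k)| = k.-1.+4 by rewrite card_ord -{1}kK.
rewrite /hs_ (pairing_rotation v_free (vec_neq0 l) A0 (wX_neq0 e) kappa0 c0 cE AF
   cN jk wep e01 cn' (fun b => EE d b)).
rewrite mulNr mulrC; congr (- (_ * _)).
have -> : (j + 2 - e0 = (j + 1 - e0).+1)%N by lia.
by rewrite exprS -(expr_mod _ wep) -exprS -exprM.
Qed.

End Stabilizer.

(** * The three types *)

Section Types.
Variables (R : realType) (k p : nat) (l : 'rV[R[i]]_k).
Local Notation C := R[i].
Local Notation sphere := (option C).
Local Notation w := (wroot R p).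
Hypotheses (k2 : (2 <= k)%N) (p2 : (2 <= p)%N) (hl : Kn l).
Hypothesis hG : stab_isog_Zp l p.
Implicit Types (s t : 'S_(3 + k)) (f psi chi : sphere -> sphere) (S T : set sphere).

Let p0 : (0 < p)%N. Proof. exact: leq_trans p2. Qed.
Let w_prim : p.-primitive_root w. Proof. exact: wroot_prim. Qed.
Let pt_inj : injective (pt l). Proof. exact/KnP. Qed.

Local Notation polar := [:: Some (0 : C); None].

(** If chi carries the marked points to a set that is stable under the rotation,
    the conjugate of the rotation permutes them, and the corresponding
    permutation s has the conjugate as f_s. *)
Lemma rotation_exists chi : is_lft chi ->
  (forall b, exists b', chi (pt l b') = scaling w (chi (pt l b))) ->
  exists s, gmap s l = l /\ conjugated_by chi (flft l s) (scaling w).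
Proof.
move=> lchi /fin_all_exists [sg sgP].
have w0 : w != 0 by apply: wroot_neq0.
have lsc : is_lft (scaling w).
  by rewrite scalingE //; exists (diagq w); rewrite // unitmxE unitfE det_diagq.
have sg_inj : injective sg.
  move=> b b' e; apply: pt_inj; apply: (is_lft_inj lchi); apply: (is_lft_inj lsc).
  by rewrite -!sgP e.
have [phi [lphi chiK phiK]] := is_lft_inv lchi.
exists (perm sg_inj).
have lf : is_lft (phi \o (scaling w \o chi)) by do 2!apply: is_lft_comp => //.
have [|-> ->] := @gmap_unique R k l l (perm sg_inj) _ hl lf.
  by move=> b; rewrite permE /= -sgP chiK.
by split=> //; apply/funext => z; rewrite /= phiK.
Qed.

(** The three types at once: T is the empty set, {0}, or {0, infinity}.  The marked
    points that chi does not send to T correspond to pairs of an orbit and an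
    exponent. *)
Lemma type_rotation m S T : union_of_orbits p m S -> T `<=` [set z | z \in polar] ->
  equivalent (range (pt l)) (T `|` S) ->
  exists chi s,
  [/\ is_lft chi, gmap s l = l, conjugated_by chi (flft l s) (scaling w),
      (3 + k = m * p + #|[pred b | chi (pt l b) \in polar]|)%N &
      (forall b, chi (pt l b) \in polar -> T (chi (pt l b))) /\
      (forall z, T z -> exists b, chi (pt l b) = z)].
Proof.
move=> [m0 [a [a0 a_inj SE]]] Tpol [chi lchi chiE].
have wX0 e : w ^+ e != 0 by rewrite expf_neq0 // wroot_neq0.
have SP z : S z <-> exists (ie : 'I_m * 'I_p), z = Some (w ^+ ie.2 * a ie.1).
  rewrite SE; split=> [[i _ [x /CpP-/(_ p0) [e ->] <-]]|[[i e] ->]]; first by exists (i, e).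
  by exists i => //; exists (w ^+ e * a i) => //; apply/CpP => //; exists e.
have Snp z : S z -> z \notin polar.
  by case/SP => -[i e] ->; rewrite !inE orbF (inj_eq Some_inj) mulf_neq0.
have inU b : (T `|` S) (chi (pt l b)) by rewrite -chiE; exists (pt l b) => //; exists b.
have Uin z : (T `|` S) z -> exists b, chi (pt l b) = z.
  by rewrite -chiE => -[_ [b _ <-] <-]; exists b.
have [|s [sl sw]] := rotation_exists lchi.
  move=> b; apply: Uin; have [/Tpol|/SP [[i e] ->]] := inU b.
    move=> pol; left; have [//|/Snp] := inU b; last by rewrite pol.
    by move: pol; rewrite /= !inE => /orP [] /eqP -> //=; rewrite mulr0.
  right; apply/SP; exists (i, Ordinal (ltn_pmod e.+1 p0)) => /=.
  by rewrite (expr_mod _ (prim_expr_order w_prim)) exprS mulrA.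
exists chi, s; split=> //; last first.
  by split=> [b pol|z Tz]; [have [//|/Snp] := inU b; rewrite pol|apply: Uin; left].
have /fin_all_exists [phi phiP] (ie : 'I_m * 'I_p) :
    exists b, chi (pt l b) = Some (w ^+ ie.2 * a ie.1).
  by apply: Uin; right; apply/SP; exists ie.
have phi_inj : injective phi.
  move=> [i e] [i' e'] ee; have /= := phiP (i, e); rewrite ee phiP /= => -[eq].
  have ii : i = i'.
    apply: a_inj; apply/seteqP.
    have sub (j j' : 'I_m) (d d' : 'I_p) :
        w ^+ d * a j = w ^+ d' * a j' -> Cp p (a j) `<=` Cp p (a j').
      move=> h x /CpP-/(_ p0) [g ->]; apply/CpP => //.
      exists (Ordinal (ltn_pmod (g + (p - d) + d') p0)) => /=.
      rewrite (expr_mod _ (prim_expr_order w_prim)) exprD -mulrA -h mulrA -!exprD.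
      rewrite -addnA subnK ?(ltnW (ltn_ord d)) // exprD (prim_expr_order w_prim) mulr1 //.
    by split; [apply: (sub _ _ e e')|apply: (sub _ _ e' e)].
  rewrite ii in eq *; congr pair; apply/val_inj/eqP.
  move/(mulIf (a0 _))/eqP: eq.
  by rewrite (eq_prim_root_expr w_prim) !modn_small // eq_sym.
rewrite -[LHS](card_ord (3 + k)) -(cardC [pred b | chi (pt l b) \in polar]) addnC.
congr (_ + _)%N; transitivity #|codom phi|; last by rewrite card_codom // card_prod !card_ord.
apply: eq_card => b; rewrite !inE; apply/idP/codomP => [npol|[ie ->]].
  have [/Tpol|/SP [ie e]] := inU b; first by rewrite /= !inE (negbTE npol).
  exists ie; apply: pt_inj; apply: (is_lft_inj lchi); by rewrite e phiP.
by rewrite phiP; apply: Snp; apply/SP; exists ie.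
Qed.

(** The transformations f_s and f_t have the same fixed points, since t is a power
    of s and f_t is not the identity; psi and chi send these fixed points, and
    no others, to 0 and infinity. *)
Lemma polar_transfer chi s psi t : is_lft chi -> is_lft psi ->
  gmap s l = l -> conjugated_by chi (flft l s) (scaling w) ->
  gmap t l = l -> conjugated_by psi (flft l t) (scaling w) ->
  forall b, (psi (pt l b) \in polar) = (chi (pt l b) \in polar).
Proof.
move=> lchi lpsi sl sw tl tw b.
have [e te] := stab_generated k2 p2 hl hG lchi sl sw tl.
have [fe _] := flft_expg e hl sl.
have cw := conjugated_iter e sw; rewrite -fe -te in cw.
have w1 : w != 1.
  apply/eqP => w1; have := prim_order_dvd w_prim 1.
  by rewrite w1 expr1n eqxx dvdn1 => /eqP p1; move: p2; rewrite p1.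
have we1 : w ^+ e != 1.
  apply: contraNneq w1 => we1; apply/eqP; apply: scaling_inj.
  have [phi [_ _ phiK]] := is_lft_inv lpsi.
  apply: (conjugated_surj lpsi tw).
  have s1 : scaling (1 : C) = id by apply/funext => -[x|] //=; rewrite mul1r.
  rewrite we1 s1 in cw; rewrite s1 /conjugated_by; apply/funext => z /=.
  congr psi; apply: (is_lft_inj lchi); exact: (congr1 (fun F => F z) cw).
by rewrite -(conjugated_fix _ lpsi w1 tw) -(conjugated_fix _ lchi we1 cw).
Qed.

Lemma mult_vector02_of (chi : sphere -> sphere) s m e0 (a : seq nat) :
  is_lft chi -> gmap s l = l -> conjugated_by chi (flft l s) (scaling w) ->
  (e0 <= 1)%N ->
  (forall psi t, is_lft psi -> gmap t l = l -> conjugated_by psi (flft l t) (scaling w) ->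
     3 + k = m * p + e0 + #|[pred b | psi (pt l b) == None]|)%N ->
  size a = p ->
  (forall j, (j < p)%N -> nth 0%N a j = \sum_(i < k) ((i + 1 - e0) %% p == j))%N ->
  mult_vector02 l p a.
Proof.
move=> lchi sl sw e01 cn sza aE; split.
  by exists (gmap s), s; split=> //; exists chi.
move=> _ [t [-> tl [psi lpsi tw]]].
exact: (jac_decomposition_of k2 p2 hl hG lpsi tl tw e01 (cn _ _ lpsi tl tw)).
Qed.

Lemma mult_vector_mC m (a : seq nat) : type_mC l p m -> size a = p ->
  (forall j, (j < p)%N -> nth 0%N a j = m - 1 + (j < p - 2) - (j == 0))%N ->
  mult_vector02 l p a.
Proof.
move=> [S uS eS] sza aE; have m0 : (0 < m)%N by case: uS.
have [|] := type_rotation uS (T := set0) (sub0set _).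
  by rewrite set0U.
move=> chi [s [lchi sl sw cn [hT _]]].
have np b : chi (pt l b) \notin polar by apply/negP => /hT.
rewrite eq_card0 in cn; last by move=> b; rewrite inE (negbTE (np b)).
rewrite addn0 in cn.
apply: (@mult_vector02_of chi s m 0) => // [psi t lpsi tl tw|j jp].
  rewrite [X in _ = (_ + X)%N]eq_card0 ?addn0 // => b; rewrite inE.
  have := polar_transfer lchi lpsi sl sw tl tw b.
  by rewrite (negbTE (np b)) !inE => /negbT; rewrite negb_or => /andP [_ /negbTE].
by rewrite aE // (count_mC p2 m0 cn jp).
Qed.

(** The marked point b0 that chi sends to 0 is fixed by the whole stabilizer.  It is
    the only marked point that is fixed by a rotation of the stabilizer other
    than the identity, so an admissible psi, which sends a marked point to 0,
    sends none to infinity. *)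
Lemma mult_vector_1mC m (a : seq nat) : type_1mC l p m -> size a = p ->
  (forall j, (j < p)%N -> nth 0%N a j = m - 1 + (j < p - 2))%N ->
  mult_vector1 l p a.
Proof.
move=> [S uS eS] sza aE; have m0 : (0 < m)%N by case: uS.
have [||chi [s [lchi sl sw cn [hT Th]]]] := type_rotation uS (T := [set Some 0]).
- by move=> z ->; rewrite /= inE eqxx.
- exact: eS.
have [b0 cb0] := Th (Some 0) erefl.
have polb0 b : (chi (pt l b) \in polar) = (b == b0).
  apply/idP/eqP => [/hT /= e|->]; last by rewrite cb0 inE eqxx.
  by apply: pt_inj; apply: (is_lft_inj lchi); rewrite e cb0.
have c1 : #|[pred b | chi (pt l b) \in polar]| = 1%N.
  rewrite -[RHS](card1 b0); apply: eq_card => b; rewrite inE [LHS]polb0.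
  by rewrite inE.
rewrite c1 in cn.
have fixb0 t : gmap t l = l -> t b0 = b0.
  move=> tl; have [e te] := stab_generated k2 p2 hl hG lchi sl sw tl.
  have [fe _] := flft_expg e hl sl.
  have cw := conjugated_iter e sw; rewrite -fe -te in cw.
  apply: pt_inj; apply: (is_lft_inj lchi); rewrite -[in LHS]tl -flft_pt // cb0.
  by have /= <- := congr1 (fun F => F (pt l b0)) cw; rewrite cb0 /= mulr0.
split.
  exists (gmap s), s; split=> //; exists b0, chi; split=> //.
  apply/seteqP; split=> [h [t tl th]|_ [j _ <-]].
    have [e te] := stab_generated k2 p2 hl hG lchi sl sw tl.
    have [fe _] := flft_expg e hl sl.
    have cw := conjugated_iter e sw; rewrite -fe -te in cw.
    by exists e => //; exact: (conjugated_surj lchi cw th).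
  have [fj jl] := flft_expg j hl sl.
  by exists (s ^+ j)%g => //; rewrite fj; exact: conjugated_iter.
move=> _ [t [-> tl [b [psi [_ lpsi psib _ tw]]]]].
have tr := polar_transfer lchi lpsi sl sw tl tw.
have bb0 : b = b0 by apply/eqP; rewrite -polb0 -tr psib inE eqxx.
apply: (jac_decomposition_of k2 p2 hl hG lpsi tl tw (m := m) (e0 := 1)) => //.
  rewrite [X in _ = (_ + X)%N]eq_card0 ?addn0 // => b'; rewrite inE; apply/negP => /eqP e.
  have : psi (pt l b') \in polar by rewrite e !inE.
  by rewrite tr polb0 -bb0 => /eqP bE; rewrite bE psib in e.
by move=> j jp; rewrite aE // (count_1mC p2 m0 cn jp).
Qed.

(** Two marked points go to 0 and infinity under chi, hence also under every
    admissible psi, though psi may exchange them. *)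
Lemma mult_vector_2mC m (a : seq nat) : type_2mC l p m -> size a = p ->
  (forall j, (j < p)%N -> nth 0%N a j = m - 1 + (j < p - 1))%N ->
  mult_vector02 l p a.
Proof.
move=> [S uS eS] sza aE; have m0 : (0 < m)%N by case: uS.
have [||chi [s [lchi sl sw cn [hT Th]]]] :=
  type_rotation uS (T := [set Some 0; None]).
- by move=> z [->|->]; rewrite /= !inE eqxx.
- exact: eS.
have inj_at f z : is_lft f -> (#|[pred b | f (pt l b) == z]| <= 1)%N.
  move=> lf; apply/card_le1P => b; rewrite inE => /eqP fb b'; rewrite !inE.
  apply/eqP/eqP => [fb'|->//].
  by apply: pt_inj; apply: (is_lft_inj lf); rewrite fb fb'.
have cpol f : is_lft f -> (#|[pred b | f (pt l b) \in polar]| =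
    #|[pred b | f (pt l b) == Some 0%R]| + #|[pred b | f (pt l b) == None]|)%N.
  move=> lf; rewrite -cardUI [X in _ = (_ + X)%N]eq_card0 ?addn0 => [|b].
    by apply: eq_card => b; rewrite !inE.
  by rewrite !inE; case: eqP => // ->.
have c2 : #|[pred b | chi (pt l b) \in polar]| = 2%N.
  have [b0 cb0] := Th (Some 0) (or_introl erefl).
  have [b1 cb1] := Th None (or_intror erefl).
  have h0 := inj_at _ (Some 0) lchi; have h1 := inj_at _ None lchi.
  have g0 : (0 < #|[pred b | chi (pt l b) == Some 0%R]|)%N.
    by apply/card_gt0P; exists b0; rewrite inE cb0.
  have g1 : (0 < #|[pred b | chi (pt l b) == None]|)%N.
    by apply/card_gt0P; exists b1; rewrite inE cb1.
  by rewrite cpol //; lia.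
rewrite c2 in cn.
apply: (@mult_vector02_of chi s m 1) => // [psi t lpsi tl tw|j jp].
  have tr := polar_transfer lchi lpsi sl sw tl tw.
  have := cpol psi lpsi; rewrite (eq_card (B := [pred b | chi (pt l b) \in polar])).
    by rewrite c2; have := inj_at psi None lpsi; have := inj_at psi (Some 0) lpsi; lia.
  by move=> b; have := tr b; rewrite !inE.
by rewrite aE // (count_2mC p2 m0 cn jp).
Qed.

End Types.

Lemma nth_nseq_cat2 (x y a j : nat) : (j < a + 2)%N ->
  nth 0%N (nseq a x ++ [:: y; y]) j = if (j < a)%N then x else y.
Proof.
move=> ja; rewrite nth_cat size_nseq nth_nseq; case: ltnP => // ja'.
have : (j - a < 2)%N by lia.
by case: (j - a)%N => [|[|n]].
Qed.

Theorem theorem21 (R : realType) (k p : nat) (hn : (5 <= 3 + k)%N)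
    (hp : (2 <= p)%N) (l : 'rV[R[i]]_k) (hl : Kn l) (hG : stab_isog_Zp l p)
    (m : nat) :
  [/\ type_mC l p m ->
        [/\ p = 2%N -> mult_vector02 l p [:: (m - 2)%N; (m - 1)%N],
            p = 3%N -> mult_vector02 l p [:: (m - 1)%N; (m - 1)%N; (m - 1)%N] &
            (4 <= p)%N ->
              mult_vector02 l p
                ([:: (m - 1)%N] ++ nseq (p - 3) m
                   ++ [:: (m - 1)%N; (m - 1)%N])],
      type_1mC l p m ->
        (p = 2%N -> mult_vector1 l p [:: (m - 1)%N; (m - 1)%N]) /\
        ((3 <= p)%N ->
           mult_vector1 l p (nseq (p - 2) m ++ [:: (m - 1)%N; (m - 1)%N])) &
      type_2mC l p m ->
        mult_vector02 l p (nseq (p - 1) m ++ [:: (m - 1)%N])].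
Proof.
have k2 : (2 <= k)%N by move: hn; rewrite -(leq_add2l 3).
split=> [hm|hm|hm]; have m0 : (0 < m)%N by case: hm => S [].
- have MV := @mult_vector_mC _ _ _ _ k2 hp hl hG m _ hm.
  split=> [e|e|p4]; apply: MV; rewrite ?e //.
  + by move=> [|[|]] //= _; lia.
  + by move=> [|[|[|]]] //= _; lia.
  + by rewrite /= size_cat size_nseq /=; lia.
  move=> [|j] jp /=; first by lia.
  by rewrite nth_nseq_cat2; [case: ifP|]; lia.
- have MV := @mult_vector_1mC _ _ _ _ k2 hp hl hG m _ hm.
  split=> [e|p3]; apply: MV; rewrite ?e //.
  + by move=> [|[|]] //= _; lia.
  + by rewrite size_cat size_nseq /=; lia.
  by move=> j jp; rewrite nth_nseq_cat2; [case: ifP|]; lia.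
apply: (mult_vector_2mC k2 hp hl hG hm).
  by rewrite size_cat size_nseq /=; lia.
move=> j jp; rewrite nth_cat size_nseq nth_nseq.
case: ltnP => jp1; first by rewrite subnK.
have -> : (j - (p - 1) = 0)%N by lia.
by rewrite /=; lia.
Qed.
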